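(* Let $d\ge 1$ and let $(a_n)_{n\in\mathbb N^d}$ be a $d$-sequence of complex numbers. Then $(a_n)_{n\in\mathbb N^d}$ is a ($d$-dimensional real) moment $d$-sequence if and only if there is a family $\{\mu_\xi\}_{\xi\in\Xi}$ of positive measures on $\mathbb R^d$ such that $$a_n^\xi=\int_{\mathbb R^d}x^n\,\mu_\xi(\mathrm dx),\qquad n\in \mathsf N_1\cup 2\mathsf N_1,\ \xi\in\Xi,$$ and $$\mu_0=0,\qquad \mu_{\xi+\eta}+\mu_{\xi-\eta}-2\mu_\eta\ge 0,\qquad \xi,\eta\in\Xi.$$
   Context: $\mathbb N=\{0,1,2,\dots\}$. For $n=(n_1,\dots,n_d)\in\mathbb N^d$ and $x=(x_1,\dots,x_d)\in\mathbb R^d$, put $|n|=n_1+\cdots+n_d$ and $x^n=x_1^{n_1}\cdots x_d^{n_d}$. Measures are Borel measures, and all integrals written are understood to exist (the integrands are absolutely integrable). A $d$-sequence $(a_n)_{n\in\mathbb N^d}$ is a ($d$-dimensional real) moment $d$-sequence if there is a positive measure $\mu$ on $\mathbb R^d$ such that $a_n=\int_{\mathbb R^d}x^n\,\mu(\mathrm dx)$ for all $n\in\mathbb N^d$. $\Xi$ denotes the complex linear space of all $d$-sequences $\xi=(\xi_n)_{n\in\mathbb N^d}$ of complex numbers which are zero for all but finitely many $n$. For $\xi\in\Xi$ define $$a_n^\xi=\sum_{k,l\in\mathbb N^d}a_{n+k+l}\,\xi_k\overline{\xi_l},\qquad n\in\mathbb N^d.$$ $\mathsf N_1=\{k\in\mathbb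 N^d:\ |k|\le 1\}$ and $2\mathsf N_1=\{2k:\ k\in\mathsf N_1\}$. In the condition $\mu_0=0$, the index $0$ is the zero element of $\Xi$; the inequality $\mu_{\xi+\eta}+\mu_{\xi-\eta}-2\mu_\eta\ge0$ means that this signed measure is positive, i.e. nonnegative on every Borel set. *)

(* Defs.v *)
From HB Require Import structures.
From mathcomp Require Import all_boot all_order all_algebra finmap.
From mathcomp Require Import all_classical all_reals all_analysis.
From mathcomp Require Import complex.
(* The notations of monalg clash with those of the analysis library. *)
From mathcomp Require Import -(notations) monalg.

Set Implicit Arguments.
Unset Strict Implicit.
Unset Printing Implicit Defensive.

Import Order.TTheory GRing.Theory Num.Theory.
Import numFieldNormedType.Exports.

Local Open Scope classical_set_scope.
Local Open Scope ring_scope.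

Notation multiindex d := {ffun 'I_d -> nat}.

Definition absm (d : nat) (n : multiindex d) : nat := (\sum_(i < d) n i)%N.

Definition N1 (d : nat) : set (multiindex d) := [set k | (absm k <= 1)%N].
Arguments N1 : clear implicits.

Definition twoN1 (d : nat) : set (multiindex d) := [set k *+ 2 | k in N1 d].
Arguments twoN1 : clear implicits.

(* The sigma-algebra generated by the open sets, i.e. the Borel one. *)
Notation Rd R d := (g_sigma_algebraType (@open 'rV[R]_d)).

Definition xpow (R : realType) (d : nat) (n : multiindex d) (x : 'rV[R]_d) : R :=
  \prod_(i < d) x 0 i ^+ n i.

Definition has_moment (R : realType) (d : nat)
    (mu : {measure set (Rd R d) -> \bar R}) (n : multiindex d) (c : R[i]) : Prop :=
  mu.-integrable [set: Rd R d] (EFin \o xpow n) /\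
  c = (\int[mu]_x xpow n x)%:C%C.

Definition moment_sequence (R : realType) (d : nat) (a : multiindex d -> R[i]) :=
  exists mu : {measure set (Rd R d) -> \bar R}, forall n, has_moment mu n (a n).

(* [malg] is the type of finitely supported functions, with their pointwise
   linear structure. *)
Notation Xi R d := (malg (multiindex d) R[i]).

Definition axi (R : realType) (d : nat) (a : multiindex d -> R[i])
    (xi : Xi R d) (n : multiindex d) : R[i] :=
  \sum_(k <- msupp xi) \sum_(l <- msupp xi)
    a (n + k + l) * mcoeff k xi * (mcoeff l xi)^*%C.

(* Main.v *)
Require Import Defs.
From HB Require Import structures.
From mathcomp Require Import all_boot all_order all_algebra finmap.
From mathcomp Require Import all_classical all_reals all_analysis.
From mathcomp Require Import measurable_realfun.
From mathcomp Require Import complex.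
From mathcomp Require Import -(notations) monalg.
From mathcomp Require Import ring lra zify.

Set Implicit Arguments.
Unset Strict Implicit.
Unset Printing Implicit Defensive.

Import Order.TTheory GRing.Theory Num.Theory.
Import numFieldNormedType.Exports.

Local Open Scope classical_set_scope.
Local Open Scope ring_scope.

(** If [mu] represents the sequence [a], the measures [mu_xi] with density
    [|p_xi|^2] with respect to [mu], where [p_xi] is the polynomial with
    coefficients [xi], have all the required moments, and the second difference
    [mu_(xi+eta) + mu_(xi-eta) - 2 mu_eta] is twice [mu_xi] by the parallelogram
    law.

    For the converse, a second difference of the family in the direction [xi],
    taken at any base point [eta], is again a positive measure; its prescribed
    moments do not depend on [eta], because [xi |-> axi a xi n] is a
    quadratic form. The mixed second differences at [eta], integrated against a
    function [g] of quadratic growth, are therefore bounded in [eta]. Averaging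
    them with a translation invariant mean on the abelian group of all [eta]
    ([invariant_mean]) gives forms [B g u v] which are linear in [g], symmetric
    and biadditive in [u] and [v], positive semidefinite when [g >= 0], and which
    have the prescribed values at [g = 1], [x_i], [x_i^2] ([form_of_family]).
    They form a finitely additive semispectral measure.

    Let [e_k] be the vector of the monomial [x^k]. The prescribed values give
    [B 1 e_(k+i) e_(k+i) - 2 B x_i e_(k+i) e_k + B (x_i^2) e_k e_k = 0], that is,
    the vector valued function [e_(k+i) - x_i e_k] has norm zero for the
    semi-inner product defined by [B]. By the Cauchy-Schwarz inequality it is
    orthogonal to everything, so that [B g q e_(k+i) = B (x_i g) q e_k] for
    bounded [g] with bounded support ([form_mul]). By iteration
    [B g e_0 e_k = B (x^k g) e_0 e_0] ([form_monomial]).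

    The finitely additive set function [A |-> B \1_A e_0 e_0] is tight, by a
    Chebyshev bound on the second moments. Its regularization
    ([content_regularization]) is a Borel measure [nu], which integrates bounded
    continuous functions as [B] does ([riesz]). Inserting continuous cutoffs
    increasing to [1] for [g], one gets [a_k = B 1 e_0 e_k] as the limit of the
    integrals of the truncated monomials, which is the moment of [nu] of index
    [k] ([moments_of_form]). *)

(** * Invariant means on abelian groups *)

Section InvariantMean.
Variables (R : realType) (G : zmodType).
Implicit Types (f g : G -> R) (s : seq G) (n : nat).

(** Boundedness of a real function on [G], with and without a named bound. *)
Definition bounded_by (C : R) f := forall x, `|f x| <= C.
Definition bdd f := exists C, bounded_by C f.

Lemma bddD f g : bdd f -> bdd g -> bdd (fun x => f x + g x).
Proof.
move=> [C Cf] [D Dg]; exists (C + D) => x.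
by rewrite (le_trans (ler_normD _ _))// lerD.
Qed.

Lemma bddZ (c : R) f : bdd f -> bdd (fun x => c * f x).
Proof. by move=> [C Cf]; exists (`|c| * C) => x; rewrite normrM ler_wpM2l. Qed.

Lemma bdd_shift (z : G) f : bdd f -> bdd (fun x => f (x + z)).
Proof. by move=> [C Cf]; exists C => x. Qed.

(** The average of [f] over [n.+1] successive translates by [z], and the iterated
    average over all the directions in [s]. *)
Definition avg n (z : G) f : G -> R :=
  fun x => n.+1%:R^-1 * \sum_(i < n.+1) f (x + z *+ i).

Definition avgs n s f : G -> R := foldr (avg n) f s.

Lemma avgsD n s f g x :
  avgs n s (fun y => f y + g y) x = avgs n s f x + avgs n s g x.
Proof.
elim: s x => //= z s IH x; rewrite /avg -mulrDr -big_split/=.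
by congr (_ * _); apply: eq_bigr => i _; rewrite IH.
Qed.

Lemma avgsZ n s (c : R) f x : avgs n s (fun y => c * f y) x = c * avgs n s f x.
Proof.
elim: s x => //= z s IH x; rewrite /avg mulrCA; congr (_ * _).
by rewrite mulr_sumr; apply: eq_bigr => i _; rewrite IH.
Qed.

Lemma avgs_ge0 n s f : (forall x, 0 <= f x) -> forall x, 0 <= avgs n s f x.
Proof.
move=> f0; elim: s => //= z s IH x.
by rewrite /avg mulr_ge0 ?invr_ge0 ?ler0n// sumr_ge0.
Qed.

Lemma avgs_cst n s (c : R) x : avgs n s (fun=> c) x = c.
Proof.
elim: s x => //= z s IH x; rewrite /avg.
under eq_bigr do rewrite IH.
by rewrite sumr_const card_ord -[c *+ _]mulr_natl mulrA mulVf ?mul1r// pnatr_eq0.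
Qed.

Lemma avgs_shift n s f (z x : G) :
  avgs n s (fun y => f (y + z)) x = avgs n s f (x + z).
Proof.
elim: s x => //= y s IH x; rewrite /avg; congr (_ * _).
by apply: eq_bigr => i _; rewrite IH addrAC.
Qed.

Lemma avgs_bounded n s f C : bounded_by C f -> bounded_by C (avgs n s f).
Proof.
move=> fC; elim: s => //= z s IH x; rewrite /avg normrM ger0_norm ?invr_ge0//.
rewrite ler_pdivrMl ?ltr0n// (le_trans (ler_norm_sum _ _ _))//.
rewrite (_ : _ * C = \sum_(i < n.+1) C); last first.
  by rewrite sumr_const card_ord mulr_natl.
by apply: ler_sum => i _; exact: IH.
Qed.

(** Averaging along [z] nearly cancels a difference by a shift along [z]: the
    sum telescopes. *)
Lemma avgs_shiftB n s f C z : bounded_by C f -> z \in s ->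
  bounded_by (2 * C / n.+1%:R) (avgs n s (fun x => f (x + z) - f x)).
Proof.
move=> fC; elim: s => //= y s IH; rewrite inE => /orP[/eqP <-|/IH zs]; last first.
  exact: (@avgs_bounded n [:: y]).
move=> x; rewrite /avg.
have E w : avgs n s (fun x => f (x + z) - f x) w = avgs n s f (w + z) - avgs n s f w.
  rewrite -avgs_shift -[- avgs n s f w]mulN1r -avgsZ -avgsD.
  by congr (avgs n s _ w); apply/funext => v; rewrite mulN1r.
under eq_bigr do rewrite E -addrA -mulrSr.
rewrite -(big_mkord xpredT
  (fun i => avgs n s f (x + z *+ i.+1) - avgs n s f (x + z *+ i))).
rewrite telescope_sumr// normrM ger0_norm ?invr_ge0// mulrC ler_wpM2r ?invr_ge0//.
rewrite (le_trans (ler_normB _ _))// mulrDl mul1r.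
by apply: lerD; exact: avgs_bounded.
Qed.

Let idx := (seq G * nat)%type.

(* The filter of all large boxes: the list of directions contains a given finite
   list, and the number of steps exceeds a given bound. *)
Let eventually_idx : set_system idx := fun P =>
  exists s0 n0, forall s n, {subset s0 <= s} -> (n0 <= n)%N -> P (s, n).

Let eventually_idx_proper : ProperFilter eventually_idx.
Proof.
split.
  by move=> [s0 [n0 /(_ s0 n0)]]; apply.
split.
- by exists [::], 0%N.
- move=> P Q [s [n Pn]] [t [m Qm]]; exists (s ++ t), (maxn n m) => u k su.
  rewrite geq_max => /andP[nk mk]; split.
    by apply: Pn => // x xs; apply: su; rewrite mem_cat xs.
  by apply: Qm => // x xs; apply: su; rewrite mem_cat xs orbT.
- by move=> P Q PQ [s [n Pn]]; exists s, n => u k su nk; apply/PQ/Pn.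
Qed.

(** A bounded function converges along an ultrafilter. *)
Lemma ultra_cvg_bounded (T : Type) (U : set_system T) (u : T -> R) (C : R) :
  UltraFilter U -> (forall i, `|u i| <= C) -> cvg (u i @[i --> U]).
Proof.
move=> UU uC.
have [|p [_ cp]] := @segment_compact R (- C) C (u i @[i --> U])
    (fmap_proper_filter _ _).
  rewrite nbhs_filterE /fmap /=; apply: filterS filterT => i _.
  by rewrite /= in_itv/= -ler_norml.
apply/cvg_ex; exists p => W Wp.
have [//|UW] := in_ultra_setVsetC (u @^-1` W) UU.
by have [y [/= +]] := cp (~` W) W UW Wp.
Qed.

(** A translation invariant mean on the bounded real functions of an abelian
    group. It is a limit, along an ultrafilter, of averages over the boxes
    spanned by finite lists of group elements. *)
Lemma invariant_mean : exists M : (G -> R) -> R,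
  [/\ forall f g, bdd f -> bdd g -> M (fun x => f x + g x) = M f + M g,
      forall c f, bdd f -> M (fun x => c * f x) = c * M f,
      forall f, bdd f -> (forall x, 0 <= f x) -> 0 <= M f,
      forall c, M (fun=> c) = c
    & forall z f, bdd f -> M (fun x => f (x + z)) = M f].
Proof.
have [U [UU leU]] := ultraFilterLemma eventually_idx_proper.
pose u f (i : idx) := avgs i.2 i.1 f 0.
have ucvg f : bdd f -> cvg (u f i @[i --> U]).
  by move=> [C fC]; apply: ultra_cvg_bounded => i; exact: avgs_bounded.
exists (fun f => lim (u f i @[i --> U])); split.
- move=> f g bf bg; rewrite -limD; [|exact: ucvg..].
  by congr (lim (_ @ U)); apply/funext => i; exact: avgsD.
- move=> c f bf; apply: cvg_lim => //.
  have -> : u (fun x => c * f x) = fun i => c * u f i.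
    by apply/funext => i; exact: avgsZ.
  by apply: cvgMr; exact: ucvg.
- move=> f bf f0; apply: limr_ge; first exact: ucvg.
  by apply: filterE => i; exact: avgs_ge0.
- move=> c; apply: cvg_lim => //; rewrite (_ : u _ = fun=> c); first exact: cvg_cst.
  by apply/funext => i; exact: avgs_cst.
- move=> z f [C fC]; have bf : bdd f by exists C.
  apply/eqP; rewrite -subr_eq0; apply/eqP.
  rewrite -limB; [|exact/ucvg/bdd_shift|exact: ucvg].
  apply: cvg_lim => //; apply/cvgrPdist_le => e e0; apply: leU.
  exists [:: z], (Num.truncn (2 * C / e)) => s n /(_ z (mem_head _ _)) zs ne.
  rewrite /= sub0r normrN.
  rewrite [X in `|X|](_ : _ = avgs n s (fun x => f (x + z) - f x) 0); last first.
    change (avgs n s (fun x => f (x + z)) 0 - avgs n s f 0 =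
            avgs n s (fun x => f (x + z) - f x) 0).
    rewrite -[- avgs n s f 0]mulN1r -avgsZ -avgsD.
    by congr (avgs n s _ 0); apply/funext => v; rewrite mulN1r.
  rewrite (le_trans (avgs_shiftB n fC zs 0))// ler_pdivrMr ?ltr0n//.
  rewrite -ler_pdivrMl// mulrC ltW// (lt_le_trans (truncnS_gt _))//.
  by rewrite ler_nat.
Qed.

End InvariantMean.

(** * Regularization of tight contents on Borel sets *)

Section BorelBasics.
Variables (R : realType) (d : nat).

Lemma borel_open (U : set 'rV[R]_d) : open U -> measurable (U : set (Rd R d)).
Proof. by move=> oU; exact: sub_sigma_algebra. Qed.

Lemma borel_closed (C : set 'rV[R]_d) :
  closed C -> measurable (C : set (Rd R d)).
Proof.
move=> cC; rewrite -[C]setCK; apply: measurableC.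
by apply: borel_open; exact: closed_openC.
Qed.

Lemma compact_closed_rV (K : set 'rV[R]_d) : compact K -> closed K.
Proof. by move=> /compact_closed; apply; exact: norm_hausdorff. Qed.

Lemma borel_compact (K : set 'rV[R]_d) :
  compact K -> measurable (K : set (Rd R d)).
Proof. by move=> /compact_closed_rV/borel_closed. Qed.

End BorelBasics.

(** A finitely additive tight content on the Borel sets of [R^d] is regularized
    into a measure: from the inside by compact sets on open sets, then from the
    outside by open sets. *)
Section Regularization.
Variables (R : realType) (d : nat) (N : set (Rd R d) -> R).
Hypothesis N_ge0 : forall A, measurable A -> 0 <= N A.
Hypothesis N_add : forall A B, measurable A -> measurable B ->
  A `&` B = set0 -> N (A `|` B) = N A + N B.
Hypothesis N_tight : forall e, 0 < e ->
  exists2 K : set 'rV[R]_d, compact K & N (~` K) <= e.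

Implicit Types (A B : set (Rd R d)) (K U V : set 'rV[R]_d).

Lemma content0 : N set0 = 0.
Proof.
have := @N_add set0 set0 measurable0 measurable0 (setI0 _).
by rewrite setU0 -[LHS]addr0 => /addrI.
Qed.

Lemma contentDI A B : measurable A -> measurable B ->
  N A = N (A `&` B) + N (A `\` B).
Proof.
move=> mA mB; rewrite -N_add ?setUIDK//.
- exact: measurableI.
- exact: measurableD.
- by apply/seteqP; split => // x [[_ ?] [_ ?]].
Qed.

Lemma le_content A B : measurable A -> measurable B -> A `<=` B -> N A <= N B.
Proof.
move=> mA mB AB; rewrite (contentDI mB mA) setIC (setIidl AB) lerDl N_ge0//.
exact: measurableD.
Qed.

Lemma content_finite_cover m (C : (set (Rd R d))^nat) A :
  (forall n, measurable (C n)) -> measurable A ->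
  (forall x, A x -> exists2 n, (n < m)%N & C n x) ->
  N A <= \sum_(n < m) N (C n).
Proof.
move=> mC; elim: m A => [|m IH] A mA AC.
  rewrite big_ord0 (_ : A = set0) ?content0// -subset0 => x /AC[].
  by move=> n; rewrite ltn0.
rewrite big_ord_recr/= (contentDI mA (mC m)) [leLHS]addrC lerD//; last first.
  by apply: le_content => //; exact: measurableI.
apply: IH => [|x [Ax nCx]]; first exact: measurableD.
have [n] := AC _ Ax; rewrite ltnS leq_eqVlt => /orP[/eqP->//|nm Cn].
by exists n.
Qed.

Let inner_set U K := compact K /\ K `<=` U.

(** The inner approximation of the content by compact sets, meant for open sets,
    and the outer measure that it generates. *)
Definition inner_content U : \bar R :=
  ereal_sup [set (N K)%:E | K in inner_set U].

Definition content_outer A : \bar R :=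
  ereal_inf [set inner_content U | U in [set U | open U /\ A `<=` U]].

Lemma inner_content_ge U K : compact K -> K `<=` U ->
  ((N K)%:E <= inner_content U)%E.
Proof. by move=> cK KU; apply: ereal_sup_ubound; exists K. Qed.

Lemma inner_content_ge0 U : (0 <= inner_content U)%E.
Proof.
by have := @inner_content_ge U set0 compact0 (@sub0set _ _); rewrite content0.
Qed.

Lemma inner_content_le U : open U -> (inner_content U <= (N U)%:E)%E.
Proof.
move=> oU; apply: ge_ereal_sup => _ [K [cK KU] <-]; rewrite lee_fin.
by apply: le_content => //; [exact: borel_compact|exact: borel_open].
Qed.

Lemma le_inner_content U V : U `<=` V -> (inner_content U <= inner_content V)%E.
Proof.
move=> UV; apply: ge_ereal_sup => _ [K [cK KU] <-].
by apply: inner_content_ge => //; exact: subset_trans UV.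
Qed.

(* The points of [U] at distance at least [r] from the complement of [U]. *)
Let shrink (r : R) U : set 'rV[R]_d := [set x | ball x r `<=` U].

Let shrink_closed r U : closed (shrink r U).
Proof.
rewrite -openC openE => x /= xU; rewrite /interior.
have [y [xy nUy]] : exists y, ball x r y /\ ~ U y.
  by move: xU => /existsNP[y] /not_implyP ?; exists y.
apply/nbhs_ballP; exists (r - `|x - y|).
  by move: xy; rewrite -ball_normE/= subr_gt0.
move=> z; rewrite -ball_normE/= => xz zU.
apply/nUy/zU; rewrite -ball_normE/=.
rewrite -(subrKA x) (le_lt_trans (ler_normD _ _))// distrC.
by rewrite -ltrBrDr.
Qed.

(** A compact set covered by open sets is covered by compact subsets of
    finitely many of them. *)
Lemma compact_cover_shrink K (U : (set 'rV[R]_d)^nat) :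
  compact K -> (forall n, open (U n)) -> K `<=` \bigcup_n U n ->
  exists m (C : (set 'rV[R]_d)^nat),
    [/\ forall n, compact (C n), forall n, C n `<=` U n &
        forall x, K x -> exists2 n, (n < m)%N & C n x].
Proof.
move=> cK oU KU.
pose r (m : nat) : R := m.+1%:R^-1.
have r0 m : 0 < r m by rewrite invr_gt0.
have rS m n : (m <= n)%N -> r n <= r m.
  by move=> mn; rewrite lef_pV2 ?posrE ?ltr0n// ler_nat.
pose W m : set 'rV[R]_d := [set x | exists2 n, (n < m)%N & shrink (r m) (U n) x].
have Wmono m n : (m <= n)%N -> W m `<=` W n.
  move=> mn x [k km Ux]; exists k; first exact: leq_trans mn.
  by apply: subset_trans Ux; apply: le_ball; exact: rS.
have KW : K `<=` cover [set: nat] (fun m => (W m)^°).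
  move=> x /KU[n _ Unx].
  have /nbhs_ballP[e /= e0 eU] : nbhs x (U n) by apply: open_nbhs_nbhs.
  pose m := maxn n.+1 (Num.truncn (2 / e)).
  have rm : r m < e / 2.
    rewrite /r -[e / 2]invrK ltf_pV2 ?posrE ?invr_gt0 ?divr_gt0 ?ltr0n// invfM invrK.
    rewrite mulrC (lt_le_trans (truncnS_gt _))// ler_nat ltnS.
    exact: leq_maxr.
  exists m => //; rewrite /interior; apply/nbhs_ballP; exists (r m) => //= y xy.
  exists n; first by rewrite leq_max leqnn.
  move=> z yz; apply: eU; rewrite [e]splitr.
  by apply: (@ball_triangle _ _ y); apply: le_ball (ltW rm) _ _.
have ccK : cover_compact K by rewrite -compact_cover.
have [|D _ KD] := ccK _ _ _ _ KW; first by move=> *; exact: open_interior.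
pose m := \max_(i <- D) i.
exists m, (fun n => K `&` shrink (r m) (U n)); split.
- move=> n; apply: (subclosed_compact _ cK); last by move=> x [].
  apply: closedI; [exact: compact_closed_rV|exact: shrink_closed].
- by move=> n x [_]; apply; exact: ballxx.
- move=> x Kx; have [i iD /interior_subset Wx] := KD _ Kx.
  have im : (i <= m)%N by apply: leq_bigmax_seq.
  by have [n nm ?] := Wmono _ _ im _ Wx; exists n.
Qed.

Lemma inner_content_sigma_subadd (U : (set 'rV[R]_d)^nat) :
  (forall n, open (U n)) ->
  (inner_content (\bigcup_n U n) <= \sum_(n <oo) inner_content (U n))%E.
Proof.
move=> oU; apply: ge_ereal_sup => _ [K [cK KU] <-].
have [m [C [cC CU KC]]] := compact_cover_shrink cK oU KU.
apply: (@le_trans _ _ (\sum_(n < m) (N (C n))%:E)%E).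
  rewrite sumEFin lee_fin; apply: content_finite_cover => //.
    by move=> n; exact: borel_compact.
  exact: borel_compact.
apply: (@le_trans _ _ (\sum_(n < m) inner_content (U n))%E).
  by apply: lee_sum => i _; exact: inner_content_ge.
rewrite -(big_mkord xpredT (fun n => inner_content (U n))).
by apply: nneseries_lim_ge => n _ _; exact: inner_content_ge0.
Qed.

Lemma content_outer_ge0 A : (0 <= content_outer A)%E.
Proof.
by apply: le_ereal_inf_tmp => _ [U _ <-]; exact: inner_content_ge0.
Qed.

Lemma le_content_outer : {homo content_outer : A B / A `<=` B >-> (A <= B)%E}.
Proof.
move=> A B AB; apply: ereal_inf_le_tmp => _ [U [oU BU] <-].
by exists U => //; split => //; exact: subset_trans BU.
Qed.

Lemma content_outer_open U : open U -> content_outer U = inner_content U.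
Proof.
move=> oU; apply/eqP; rewrite eq_le; apply/andP; split.
  by apply: ereal_inf_lbound; exists U => //; split.
apply: le_ereal_inf_tmp => _ [V [oV UV] <-]; exact: le_inner_content.
Qed.

Lemma content_outer0 : content_outer set0 = 0%E.
Proof.
apply/eqP; rewrite eq_le content_outer_ge0 andbT content_outer_open; last exact: open0.
by have := inner_content_le (@open0 _); rewrite content0.
Qed.

Lemma content_outer_fin A : content_outer A \is a fin_num.
Proof.
rewrite ge0_fin_numE ?content_outer_ge0//.
apply: (@le_lt_trans _ _ (N setT)%:E); last exact: ltry.
apply: (le_trans (le_content_outer (@subsetT _ A))).
rewrite content_outer_open; last exact: openT.
by apply: inner_content_le; exact: openT.
Qed.

Lemma content_outer_approx A (e : R) : 0 < e ->
  exists U, [/\ open U, A `<=` U & (inner_content U <= content_outer A + e%:E)%E].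
Proof.
move=> e0; have [_ [U [oU AU] <-] lt] := lb_ereal_inf_adherent e0 (content_outer_fin A).
by exists U; split => //; exact: ltW.
Qed.

Lemma content_outer_sigma_subadd : sigma_subadditive content_outer.
Proof.
move=> A; apply/lee_addgt0Pr => e e0.
have e2 n : 0 < e / (2 ^ n.+1)%:R by rewrite divr_gt0// ltr0n expn_gt0.
have /choice[U UP] : forall n, exists U, [/\ open U, A n `<=` U &
    (inner_content U <= content_outer (A n) + (e / (2 ^ n.+1)%:R)%:E)%E].
  by move=> n; exact: content_outer_approx.
apply: (@le_trans _ _ (inner_content (\bigcup_n U n))).
  rewrite -content_outer_open; last by apply: bigcup_open => n _; have [] := UP n.
  apply: le_content_outer => x [n _ Ax]; exists n => //.
  by have [_ + _] := UP n; apply.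
apply: le_trans (inner_content_sigma_subadd _) _.
  by move=> n; have [] := UP n.
apply: le_trans (epsilon_trick _ (fun n => content_outer_ge0 (A n)) (ltW e0)).
apply: lee_nneseries => n _; first by move=> _; exact: inner_content_ge0.
by have [] := UP n.
Qed.

HB.instance Definition _ := isOuterMeasure.Build R _ content_outer
  content_outer0 content_outer_ge0 le_content_outer content_outer_sigma_subadd.

Lemma inner_content_approx U (e : R) : open U -> 0 < e ->
  exists K, [/\ compact K, K `<=` U & (inner_content U <= (N K + e)%:E)%E].
Proof.
move=> oU e0; have fU : inner_content U \is a fin_num.
  by rewrite -content_outer_open// content_outer_fin.
have [_ [K [cK KU] <-] lt] := ub_ereal_sup_adherent e0 fU.
by exists K; split => //; move: lt; rewrite lteBlDr// => /ltW.
Qed.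

(** Open sets are measurable for the outer measure: exhaust [U `&` V] by a compact
    set [K], then exhaust the open set [U `\` K] by a compact set [L]. *)
Lemma open_caratheodory V : open V -> content_outer.-caratheodory V.
Proof.
move=> oV; apply: le_caratheodory_measurable => X.
suff : (content_outer (X `&` V) + content_outer (X `&` ~` V) <=
        content_outer X)%E by [].
apply/lee_addgt0Pr => e e0; have e3 : 0 < e / 3 by rewrite divr_gt0.
have [U [oU XU leU]] := content_outer_approx X e3.
have [K [cK KUV leK]] := inner_content_approx (openI oU oV) e3.
have oUK : open (U `\` K).
  by apply: openI => //; apply: closed_openC; exact: compact_closed_rV.
have [L [cL LUK leL]] := inner_content_approx oUK e3.
have h1 : (content_outer (X `&` V) <= (N K + e / 3)%:E)%E.
  apply: le_trans leK; rewrite -content_outer_open; last exact: openI.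
  by apply: le_content_outer; exact: setSI.
have h2 : (content_outer (X `&` ~` V) <= (N L + e / 3)%:E)%E.
  apply: le_trans leL; rewrite -content_outer_open//.
  apply: le_content_outer => x [Xx nVx]; split; first exact: XU.
  by move=> /KUV[].
apply: le_trans (leeD h1 h2) _.
have h3 : ((N K + N L)%:E <= inner_content U)%E.
  rewrite -N_add; [|exact: borel_compact..|].
    apply: inner_content_ge; first exact: compactU.
    by move=> x [/KUV[]//|/LUK[]].
  by apply/seteqP; split => // x [Kx /LUK[]].
move: (content_outer X) (content_outer_fin X) (le_trans h3 leU).
move=> [x| |]//= _; rewrite -!EFinD !lee_fin {leU leK leL h1 h2 h3}; lra.
Qed.

Let regularization : set (Rd R d) -> \bar R := content_outer.

Let reg_sigma_additive : semi_sigma_additive regularization.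
Proof.
have sub : @measurable _ (Rd R d) `<=` content_outer.-caratheodory.
  apply: smallest_sub => [|U oU]; last exact: open_caratheodory.
  split => [|A mA|F mF].
  - exact: caratheodory_measurable_set0.
  - by rewrite setTD; exact: caratheodory_measurable_setC.
  - exact: caratheodory_measurable_bigcup.
move=> F mF tF mUF.
by apply: (@caratheodory_measure_sigma_additive _ _ content_outer) => //;
  [move=> n|]; exact: sub.
Qed.

HB.instance Definition _ := measure_function.isMeasure.Build _ _ _ regularization
  content_outer0 content_outer_ge0 reg_sigma_additive.

Lemma content_regularization : exists mu : {measure set (Rd R d) -> \bar R},
  mu setT = (N setT)%:E /\ forall U, open U -> (mu U <= (N U)%:E)%E.
Proof.
have le U : open U -> (regularization U <= (N U)%:E)%E.
  by move=> oU; rewrite /regularization content_outer_open// inner_content_le.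
exists regularization; split; last exact: le.
apply/eqP; rewrite eq_le le/=; last exact: openT.
apply/lee_addgt0Pr => e /N_tight[K cK NK].
rewrite /regularization content_outer_open; last exact: openT.
apply: (@le_trans _ _ ((N K)%:E + e%:E)%E); last first.
  by rewrite leeD2r// inner_content_ge.
have mK := borel_compact cK.
rewrite -EFinD lee_fin (contentDI (@measurableT _ _) mK) setTI setTD.
by rewrite lerD2l.
Qed.

End Regularization.

(** * Positive forms of functions *)

Section Dominated.
Context {disp : measure_display} {T : measurableType disp} {R : realType}.
Variable w : T -> R.
Implicit Types (f g h : T -> R) (A : set T).

(** The measurable functions bounded in modulus by a multiple of [w]. *)
Definition dominated g :=
  measurable_fun [set: T] g /\ exists C : R, forall x, `|g x| <= C * w x.

Lemma dominatedD g h :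
  dominated g -> dominated h -> dominated (fun x => g x + h x).
Proof.
move=> [mg [C Cg]] [mh [D Dh]]; split; first exact: measurable_funD.
exists (C + D) => x; rewrite mulrDl (le_trans (ler_normD _ _))//.
exact: lerD.
Qed.

Lemma dominatedZ (c : R) g : dominated g -> dominated (fun x => c * g x).
Proof.
move=> [mg [C Cg]]; split; first by apply: measurable_funM => //.
by exists (`|c| * C) => x; rewrite normrM -mulrA ler_wpM2l.
Qed.

Lemma dominated_le g h :
  dominated g -> measurable_fun [set: T] h -> (forall x, `|h x| <= `|g x|) ->
  dominated h.
Proof.
move=> [_ [C Cg]] mh hg; split => //; exists C => x.
exact: le_trans (hg x) (Cg x).
Qed.

Lemma dominated_sum (I : Type) (s : seq I) (F : I -> T -> R) :
  dominated (fun=> 0) -> (forall i, dominated (F i)) ->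
  dominated (fun x => \sum_(i <- s) F i x).
Proof.
move=> dom0 dF; elim: s => [|i s IH].
  by under eq_fun do rewrite big_nil.
under eq_fun do rewrite big_cons.
exact: dominatedD.
Qed.

Hypothesis w_ge1 : forall x, 1 <= w x.

Lemma dominated_bounded g (C : R) :
  measurable_fun [set: T] g -> (forall x, `|g x| <= C) -> dominated g.
Proof.
move=> mg gC; split => //; exists C => x; apply: (le_trans (gC x)).
by rewrite ler_peMr// (le_trans _ (gC x)).
Qed.

Lemma dominated_cst (c : R) : dominated (fun=> c).
Proof. by apply: (@dominated_bounded _ `|c|). Qed.

Lemma dominated_indic A : measurable A -> dominated (\1_A).
Proof.
move=> mA; apply: (@dominated_bounded _ 1); first exact: measurable_indic.
by move=> x; rewrite indicE ger0_norm ?ler0n// lern1 leq_b1.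
Qed.

Lemma dominated_indicM A g :
  measurable A -> dominated g -> dominated (fun x => \1_A x * g x).
Proof.
move=> mA dg; apply: (dominated_le dg).
  by apply: measurable_funM; [exact: measurable_indic|case: dg].
move=> x; rewrite indicE; case: (x \in A); first by rewrite mul1r.
by rewrite mul0r normr0.
Qed.

End Dominated.

(** A positive form valued functional [B]: on functions dominated by [w],
    [B g] is a symmetric biadditive form, linear in [g], and positive
    semidefinite when [g] is nonnegative. *)
Record positive_form {disp : measure_display} {T : measurableType disp}
    {R : realType} {V : zmodType} (w : T -> R)
    (B : (T -> R) -> V -> V -> R) : Prop := PositiveForm {
  form_addl : forall g h u v, dominated w g -> dominated w h ->
    B (fun x => g x + h x) u v = B g u v + B h u v ;
  form_scalel : forall c g u v, dominated w g ->
    B (fun x => c * g x) u v = c * B g u v ;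
  form_sym : forall g u v, dominated w g -> B g u v = B g v u ;
  form_add : forall g u v v', dominated w g ->
    B g u (v + v') = B g u v + B g u v' ;
  form_ge0 : forall g u, dominated w g -> (forall x, 0 <= g x) -> 0 <= B g u u
}.

Lemma measurable_ltc {disp : measure_display} {T : measurableType disp}
    {R : realType} (f : T -> R) (c : R) :
  measurable_fun [set: T] f -> measurable [set x | f x < c].
Proof.
move=> mf; rewrite -[X in measurable X]setTI.
have -> : [set x | f x < c] = f @^-1` `]-oo, c[.
  by apply/seteqP; split => x /=; rewrite in_itv.
by apply: mf => //; exact: measurable_itv.
Qed.

Lemma measurable_gec {disp : measure_display} {T : measurableType disp}
    {R : realType} (f : T -> R) (c : R) :
  measurable_fun [set: T] f -> measurable [set x | c <= f x].
Proof.
move=> mf; rewrite -[X in measurable X]setCK; apply: measurableC.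
have -> : ~` [set x | c <= f x] = [set x | f x < c].
  by apply/seteqP; split => x /=; rewrite ltNge => /negP.
exact: measurable_ltc.
Qed.

Lemma archi_ge0 (R : realType) (C y : R) :
  (forall k, - C <= k.+1%:R * y) -> 0 <= y.
Proof.
move=> H; rewrite leNgt; apply/negP => y0.
have y0' : 0 < - y by rewrite oppr_gt0.
have := H (Num.truncn (C / - y)); apply/negP; rewrite -ltNge ltrNr -mulrN.
by rewrite -ltr_pdivrMr//; exact: truncnS_gt.
Qed.

Section PositiveForm.
Context {disp : measure_display} {T : measurableType disp} {R : realType}.
Context {V : zmodType} {w : T -> R} {B : (T -> R) -> V -> V -> R}.
Hypothesis w_ge1 : forall x, 1 <= w x.
Hypothesis pB : positive_form w B.
Implicit Types (f g h : T -> R) (A : set T) (u v : V).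

Local Notation dom := (dominated w).

Lemma form_zero u v : B (fun=> 0) u v = 0.
Proof.
rewrite -[RHS](mul0r (B (fun=> 0) u v)) -(form_scalel pB); last exact: dominated_cst.
by congr (B _ u v); apply/funext => x; rewrite mul0r.
Qed.

Lemma formBl g h u v : dom g -> dom h ->
  B (fun x => g x - h x) u v = B g u v - B h u v.
Proof.
move=> dg dh; rewrite -[- B h u v]mulN1r -(form_scalel pB)//.
rewrite -(form_addl pB)//; last exact: dominatedZ.
by congr (B _ u v); apply/funext => x; rewrite mulN1r.
Qed.

Lemma form_suml (I : Type) (s : seq I) (F : I -> T -> R) u v :
  (forall i, dom (F i)) ->
  B (fun x => \sum_(i <- s) F i x) u v = \sum_(i <- s) B (F i) u v.
Proof.
move=> dF; elim: s => [|i s IH].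
  rewrite big_nil -[RHS](form_zero u v); congr (B _ u v).
  by apply/funext => x; rewrite big_nil.
rewrite big_cons -IH -(form_addl pB)//.
  by congr (B _ u v); apply/funext => x; rewrite big_cons.
by apply: dominated_sum => //; exact: dominated_cst.
Qed.

Lemma form_addr g u u' v : dom g -> B g (u + u') v = B g u v + B g u' v.
Proof. by move=> dg; rewrite !(form_sym pB _ v)// (form_add pB). Qed.

Lemma form0 g u : dom g -> B g u 0 = 0.
Proof.
move=> dg; have := form_add pB u 0 0 dg.
by rewrite addr0 -[LHS]addr0 => /addrI.
Qed.

Lemma formN g u v : dom g -> B g u (- v) = - B g u v.
Proof.
by move=> dg; apply/eqP; rewrite -addr_eq0 -(form_add pB)// addNr form0.
Qed.

Lemma formMn g u v n : dom g -> B g u (v *+ n) = n%:R * B g u v.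
Proof.
move=> dg; elim: n => [|n IH]; first by rewrite mulr0n mul0r form0.
by rewrite mulrS (form_add pB)// IH -(natr1 n) mulrDl mul1r addrC.
Qed.

Lemma formMz g u v (z : int) : dom g -> B g u (v *~ z) = z%:~R * B g u v.
Proof.
move=> dg; case: z => n; first by rewrite formMn.
by rewrite NegzE mulrNz formN// -pmulrn formMn// mulrNz mulNr.
Qed.

Lemma form_sqrD g u v : dom g ->
  B g (u + v) (u + v) = B g u u + 2 * B g u v + B g v v.
Proof.
move=> dg; rewrite (form_add pB)// !form_addr// (form_sym pB v u)//; ring.
Qed.

Lemma form_sqrB g u v : dom g ->
  B g (u - v) (u - v) = B g u u - 2 * B g u v + B g v v.
Proof.
move=> dg; rewrite form_sqrD// !formN// (form_sym pB (- v))// formN//; ring.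
Qed.

Lemma le_form g h u : dom g -> dom h -> (forall x, g x <= h x) ->
  B g u u <= B h u u.
Proof.
move=> dg dh gh; rewrite -subr_ge0 -formBl//; apply: (form_ge0 pB).
  have := dominatedD dh (dominatedZ (-1) dg).
  by congr dominated; apply/funext => x; rewrite mulN1r.
by move=> x; rewrite subr_ge0.
Qed.

(** Domination of the off-diagonal values, an additive form of
    the Cauchy-Schwarz inequality. *)
Lemma form_dominated f h u v : dom f -> dom h -> (forall x, `|h x| <= f x) ->
  2 * `|B h u v| <= B f u u + B f v v.
Proof.
move=> df dh hf.
suff key u' v' : - (2 * B h u' v') <= B f u' u' + B f v' v'.
  have := key u (- v); have := key u v.
  rewrite !formN// (form_sym pB (- v))// formN//.
  by case: (ger0P (B h u v)) => _; lra.
have dN : dom (fun x => f x - h x).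
  have := dominatedD df (dominatedZ (-1) dh).
  by congr dominated; apply/funext => x; rewrite mulN1r.
have := form_ge0 pB (u' + v') (dominatedD df dh) _.
have := form_ge0 pB (u' - v') dN _.
have a1 x : 0 <= f x - h x.
  by rewrite subr_ge0 (le_trans _ (hf x))// ler_norm.
have a2 x : 0 <= f x + h x.
  by rewrite -lerBlDr sub0r (le_trans _ (hf x))// ler_normr lexx orbT.
move=> /(_ a1) + /(_ a2).
rewrite (form_sqrB _ _ dN) (form_sqrD _ _ (dominatedD df dh)).
rewrite !formBl// !(form_addl pB)//; lra.
Qed.

Lemma indicU (A C : set T) : A `&` C = set0 ->
  \1_(A `|` C) = (fun x => \1_A x + \1_C x) :> (T -> R).
Proof.
move=> dis; apply/funext => x; rewrite !indicE in_setU.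
have [xA|] := boolP (x \in A); have [xC|] := boolP (x \in C) => //=.
- by have : (A `&` C) x; [split; exact: set_mem|rewrite dis].
- by rewrite addr0.
- by rewrite add0r.
- by rewrite addr0.
Qed.

Section Multiplication.
Variable X : T -> R.
Hypothesis domX : dom X.
Hypothesis domX2 : dom (fun x => X x ^+ 2).

Let domXA A : measurable A -> dom (fun x => \1_A x * X x).
Proof. by move=> mA; exact: dominated_indicM. Qed.

Let domX2A A : measurable A -> dom (fun x => \1_A x * X x ^+ 2).
Proof. by move=> mA; exact: dominated_indicM. Qed.

Let domA A : measurable A -> dom (\1_A).
Proof. exact: dominated_indic. Qed.

(** The square norm over [A] of the vector valued function [u - X v]. *)
Definition energy u v A : R :=
  B \1_A u u - 2 * B (fun x => \1_A x * X x) u v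
  + B (fun x => \1_A x * X x ^+ 2) v v.

Lemma energyU u v A C : measurable A -> measurable C -> A `&` C = set0 ->
  energy u v (A `|` C) = energy u v A + energy u v C.
Proof.
move=> mA mC dis; rewrite /energy.
have -> : (fun x => \1_(A `|` C) x * X x) =
    (fun x => \1_A x * X x + \1_C x * X x).
  by apply/funext => x; rewrite (indicU dis) mulrDl.
have -> : (fun x => \1_(A `|` C) x * X x ^+ 2) =
    (fun x => \1_A x * X x ^+ 2 + \1_C x * X x ^+ 2).
  by apply/funext => x; rewrite (indicU dis) mulrDl.
rewrite (indicU dis) (form_addl pB _ _ (domA mA) (domA mC)).
rewrite (form_addl pB _ _ (domXA mA) (domXA mC)).
rewrite (form_addl pB _ _ (domX2A mA) (domX2A mC)); ring.
Qed.

Lemma form_indicU u A C : measurable A -> measurable C -> A `&` C = set0 ->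
  B \1_(A `|` C) u u = B \1_A u u + B \1_C u u.
Proof.
by move=> mA mC dis; rewrite (indicU dis) (form_addl pB)//; exact: domA.
Qed.

Lemma form_indic_ge0 u A : measurable A -> 0 <= B \1_A u u.
Proof. by move=> mA; apply: (form_ge0 pB) => //; exact: domA. Qed.

(** On a cell where [X] is nearly a rational constant [z / k], the energy is
    nearly the nonnegative value of the form at [k u - z v], divided by [k ^ 2]. *)
Lemma energy_cell u v A (k : nat) (z : int) (r : R) : measurable A ->
  (0 < k)%N -> (forall x, A x -> `|X x| <= r) -> `|z%:~R / k%:R : R| <= r ->
  (forall x, A x -> `|X x - z%:~R / k%:R| <= k%:R^-1) ->
  - (k%:R^-1 * (B \1_A u u + (1 + 2 * r) * B \1_A v v)) <= energy u v A.
Proof.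
move=> mA k0 Xr; set c : R := z%:~R / k%:R; move=> cr Xc.
set e : R := k%:R^-1.
have k0' : 0 < k%:R :> R by rewrite ltr0n.
have e0 : 0 < e by rewrite invr_gt0.
have dA := domA mA; have dXA := domXA mA; have dX2A := domX2A mA.
have h1 : 0 <= B \1_A u u - 2 * c * B \1_A u v + c ^+ 2 * B \1_A v v.
  (* Only integer multiples of vectors exist in [V]: clear the denominator of
     [c] before using positivity. *)
  have := form_ge0 pB (u *~ k - v *~ z) dA _.
  rewrite form_sqrB// !formMz// !(form_sym pB (_ *~ _))// !formMz//.
  rewrite (form_sym pB v u)//.
  have -> : forall a b d : R, (k%:~R * (k%:~R * a)) - 2 * (z%:~R * (k%:~R * b)) +
      z%:~R * (z%:~R * d) = k%:R ^+ 2 * (a - 2 * c * b + c ^+ 2 * d).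
    by move=> a b d; rewrite /c -pmulrn; field; rewrite gt_eqF.
  rewrite pmulr_rge0 ?exprn_gt0//; apply => x.
  by rewrite indicE.
have de : dom (fun x => e * \1_A x) by exact: dominatedZ.
have h2 : 2 * `|B (fun x => \1_A x * X x - c * \1_A x) u v| <=
    e * (B \1_A u u + B \1_A v v).
  rewrite mulrDr -(form_scalel pB e u u dA) -(form_scalel pB e v v dA).
  apply: form_dominated => //.
    have := dominatedD dXA (dominatedZ (- c) dA).
    by congr dominated; apply/funext => x; rewrite mulNr.
  move=> x; rewrite indicE; case: (boolP (x \in A)); last by rewrite mul0r !mulr0 subr0 normr0.
  by move=> /set_mem Ax; rewrite mul1r !mulr1; exact: Xc.
have h3 : 2 * `|B (fun x => \1_A x * X x ^+ 2 - c ^+ 2 * \1_A x) v v| <=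
    2 * (e * (2 * r) * B \1_A v v).
  rewrite -(form_scalel pB _ v v dA) [leRHS]mulr_natl mulr2n.
  apply: form_dominated; first exact: dominatedZ.
    have := dominatedD dX2A (dominatedZ (- c ^+ 2) dA).
    by congr dominated; apply/funext => x; rewrite mulNr.
  move=> x; rewrite indicE; case: (boolP (x \in A)); last by rewrite mul0r !mulr0 subr0 normr0.
  move=> /set_mem Ax; rewrite mul1r !mulr1 subr_sqr normrM.
  apply: ler_pM => //; first exact: Xc.
  rewrite (le_trans (ler_normD _ _))//; have := Xr _ Ax; lra.
have dcA : dom (fun x => c * \1_A x) by exact: dominatedZ.
have dc2A : dom (fun x => c ^+ 2 * \1_A x) by exact: dominatedZ.
move: h2 h3; rewrite !formBl// !(form_scalel pB)//.
rewrite /energy ler_pM2l// => h2 h3.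
have := ler_norm (B (fun x => \1_A x * X x) u v - c * B \1_A u v).
have := ler_norm (- (B (fun x => \1_A x * X x ^+ 2) v v - c ^+ 2 * B \1_A v v)).
rewrite normrN; move: h1 h2 h3; rewrite -/e.
set n1 := `|_|; set n2 := `|_|; set b1 := B \1_A u u; set b2 := B \1_A v v.
move=> h1 h2 h3 h4 h5.
have -> : e * (b1 + (1 + 2 * r) * b2) = e * (b1 + b2) + e * (2 * r) * b2 by ring.
lra.
Qed.

(** The energy is nonnegative on sets where [X] is bounded: cut the range of [X]
    into strips of width [1 / k], sum the errors of [energy_cell], and let [k] go
    to infinity. *)
Lemma energy_ge0 u v A (N : nat) : measurable A ->
  (forall x, A x -> `|X x| < N%:R) -> 0 <= energy u v A.
Proof.
move=> mA AN.
pose K C : R := B \1_C u u + (1 + 2 * N%:R) * B \1_C v v.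
apply: (@archi_ge0 _ (K A)) => k'; set k := k'.+1.
have k0 : 0 < k%:R :> R by rewrite ltr0n.
have mX : measurable_fun [set: T] X by case: domX.
pose S i : set T := A `&` [set x | X x < i%:R / k%:R - N%:R].
have mS i : measurable (S i).
  by apply: measurableI => //; exact: measurable_ltc.
have step i : (i <= 2 * N * k)%N -> - (k%:R^-1 * K (S i)) <= energy u v (S i).
  elim: i => [_|i IH iN].
    have -> : S 0%N = set0.
      apply/seteqP; split => // x [/AN]; rewrite ltr_norml => /andP[h _] /=.
      by rewrite mul0r sub0r ltNge (ltW h).
    rewrite /K /energy indic0 !form_zero.
    have -> : (fun x => cst 0 x * X x) = fun=> 0.
      by apply/funext => x; rewrite mul0r.
    have -> : (fun x => cst 0 x * X x ^+ 2) = fun=> 0.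
      by apply/funext => x; rewrite mul0r.
    by rewrite !form_zero; lra.
  pose C := S i.+1 `\` S i.
  have mC : measurable C by exact: measurableD.
  have SC : S i.+1 = S i `|` C.
    apply/seteqP; split => [x Sx|x [[Ax]|[]//]].
      by have [?|?] := pselect (S i x); [left|right].
    move=> /= lt; split => //=; rewrite (lt_le_trans lt)// lerD2r ler_pM2r ?invr_gt0//.
    by rewrite ler_nat.
  have disS : S i `&` C = set0 by apply/seteqP; split => // x [? []].
  rewrite SC energyU// /K !form_indicU//.
  have := IH (ltnW iN).
  have := @energy_cell u v C k (i%:Z - (N * k)%:Z) N%:R mC isT _ _ _.
  have zE : (i%:Z - (N * k)%:Z)%:~R / k%:R = i%:R / k%:R - N%:R :> R.
    by rewrite intrB -!pmulrn natrM; field; rewrite gt_eqF.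
  rewrite zE => /(_ _ _ _) cell.
  have c1 x : C x -> `|X x| <= N%:R by move=> [[/AN/ltW]].
  have c2 : `|i%:R / k%:R - N%:R : R| <= N%:R.
    have iN' : i%:R / k%:R <= 2 * N%:R :> R.
      by rewrite ler_pdivrMr// -!natrM ler_nat ltnW.
    have i0 : 0 <= i%:R / k%:R :> R by rewrite divr_ge0.
    by rewrite ler_norml; apply/andP; split; lra.
  have c3 x : C x -> `|X x - (i%:R / k%:R - N%:R)| <= k%:R^-1.
    move=> [[Ax /= lt] nS].
    have ge : i%:R / k%:R - N%:R <= X x.
      by rewrite leNgt; apply/negP => lt'; apply: nS.
    rewrite ger0_norm ?subr_ge0// lerBlDr (le_trans (ltW lt))//.
    by rewrite -natr1 mulrDl mul1r; lra.
  by have := cell c1 c2 c3; rewrite /K; set ki := k%:R^-1; nra.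
have -> : A = S (2 * N * k)%N.
  apply/seteqP; split => [x Ax|x []//]; split => //=.
  rewrite !natrM mulfK ?gt_eqF// mulr_natl mulr2n addrK.
  by have := AN _ Ax; rewrite ltr_norml => /andP[].
by rewrite -ler_pdivrMl// mulrN; exact: step.
Qed.

Variables p p' : V.
Hypothesis Hx : B (fun=> 1) p' p' = B X p' p.
Hypothesis Hx2 : B (fun=> 1) p' p' = B (fun x => X x ^+ 2) p p.

(** By [Hx] and [Hx2], the total energy of [p' - X p] vanishes;
    the part where [X] is large contributes a negligible amount, hence the energy
    vanishes on every set where [X] is bounded. *)
Lemma energy_eq0 A (N : nat) : measurable A ->
  (forall x, A x -> `|X x| < N%:R) -> energy p' p A = 0.
Proof.
move=> mA AN; apply/eqP; rewrite eq_le (energy_ge0 _ _ mA AN) andbT.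
have mX : measurable_fun [set: T] X by case: domX.
pose b2 v := B (fun x => X x ^+ 2) v v.
rewrite -oppr_ge0; apply: (@archi_ge0 _ (b2 p' + b2 p)) => k.
rewrite mulrN lerN2; pose M := maxn k.+1 N.
pose S : set T := [set x | `|X x| < M%:R].
have mS : measurable S.
  by apply: measurable_ltc; exact: measurableT_comp.
have AS : A `<=` S.
  move=> x /AN /= lt; apply: (lt_le_trans lt); rewrite ler_nat; exact: leq_maxr.
have M0 : 0 < M%:R :> R by rewrite ltr0n (leq_trans _ (leq_maxl _ _)).
have tot : energy p' p setT = 0.
  rewrite /energy indicT.
  rewrite (_ : (fun x => cst 1 x * X x) = X); last first.
    by apply/funext => x; rewrite mul1r.
  rewrite (_ : (fun x => cst 1 x * X x ^+ 2) = fun x => X x ^+ 2); last first.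
    by apply/funext => x; rewrite mul1r.
  by rewrite -Hx -Hx2; ring.
have mSc : measurable (~` S) by exact: measurableC.
have mSA : measurable (S `\` A) by exact: measurableD.
have SE : energy p' p S = energy p' p A + energy p' p (S `\` A).
  by rewrite -energyU// ?setDUK// setDIK.
have : energy p' p S + energy p' p (~` S) = 0.
  by rewrite -energyU// ?setUv// setICr.
have : 0 <= energy p' p (S `\` A).
  by apply: (@energy_ge0 _ _ _ M) => // x [].
have tail : - (M%:R^-1 * (b2 p' + b2 p)) <= energy p' p (~` S).
  have := @form_dominated (fun x => M%:R^-1 * X x ^+ 2)
    (fun x => \1_(~` S) x * X x) p' p (dominatedZ _ domX2) (domXA mSc).
  have dom' x : `|\1_(~` S) x * X x| <= M%:R^-1 * X x ^+ 2.
    rewrite indicE; case: (boolP (x \in ~` S)) => [/set_mem|_]; last first.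
      by rewrite mul0r normr0 mulr_ge0 ?invr_ge0 ?sqr_ge0 ?ltW.
    rewrite /S/= => /negP; rewrite -leNgt mul1r => XM.
    by rewrite ler_pdivlMl// -(real_normK (num_real (X x))) expr2 ler_wpM2r.
  move=> /(_ dom'); rewrite !(form_scalel pB)// -mulrDr -/(b2 p') -/(b2 p).
  have := ler_norm (B (fun x => \1_(~` S) x * X x) p' p).
  have := form_indic_ge0 p' mSc.
  have : 0 <= B (fun x => \1_(~` S) x * X x ^+ 2) p p.
    apply: (form_ge0 pB); first exact: domX2A.
    by move=> x; rewrite mulr_ge0 ?sqr_ge0// indicE.
  by rewrite /energy; lra.
rewrite SE => h1 h2.
have : energy p' p A <= M%:R^-1 * (b2 p' + b2 p) by lra.
rewrite ler_pdivlMl//; apply: le_trans.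
rewrite ler_wpM2r ?(energy_ge0 _ _ mA AN)// ler_nat; exact: leq_maxl.
Qed.

(** A vector valued function of zero energy is orthogonal to everything: the
    energy of [q + m (p' - X p)] is nonnegative and affine in the integer [m], so
    its slope is zero. *)
Lemma form_mul_indic q A (N : nat) : measurable A ->
  (forall x, A x -> `|X x| < N%:R) ->
  B \1_A q p' = B (fun x => \1_A x * X x) q p.
Proof.
move=> mA AN; have dA := domA mA; have dXA := domXA mA; have dX2A := domX2A mA.
pose D := B \1_A q p' - B (fun x => \1_A x * X x) q p.
have key (m : int) : 0 <= B \1_A q q + 2 * m%:~R * D.
  have := energy_ge0 (q + p' *~ m) (p *~ m) mA AN.
  rewrite /energy form_sqrD// !formMz// !(form_sym pB (_ *~ _))// !formMz//.
  rewrite (form_sym pB (q + _))// (form_add pB)// formMz//.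
  have := energy_eq0 mA AN; rewrite /energy (form_sym pB p q)// (form_sym pB p p')//.
  rewrite /D; set m' := m%:~R : R.
  set a := B _ p' p'; set b := B _ p' p; set c := B _ p p => h.
  have : m' ^+ 2 * (a - 2 * b + c) = 0 by rewrite h mulr0.
  by nra.
apply/eqP; rewrite -subr_eq0 -/D eq_le; apply/andP; split.
- rewrite -oppr_ge0; apply: (@archi_ge0 _ (B \1_A q q / 2)) => k.
  by have := key (- (k.+1%:Z)); rewrite mulrNz -pmulrn; lra.
- apply: (@archi_ge0 _ (B \1_A q q / 2)) => k.
  by have := key k.+1%:Z; rewrite -pmulrn; lra.
Qed.

End Multiplication.
End PositiveForm.

(** * Multiplication operators and positive forms *)

Section LayerCake.
Context {disp : measure_display} {T : measurableType disp} {R : realType}.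
Implicit Type g : T -> R.

(** Superlevel sets at the heights [(j + 1) / (n + 1)]. *)
Definition level g n (j : nat) : set T := [set x | j.+1%:R / n.+1%:R <= g x].

(** The staircase approximation of a function with values in [[0, 1]] by an
    average of indicators of superlevel sets. *)
Definition layer g n : T -> R :=
  fun x => n.+1%:R^-1 * \sum_(j < n.+1) \1_(level g n j) x.

Lemma sum_le_nat (s : R) (n : nat) : 0 <= s ->
  (\sum_(j < n) (j.+1%:R <= s :> R))%N = minn n (Num.truncn s).
Proof.
move=> s0; elim: n => [|n IH]; first by rewrite big_ord0 min0n.
rewrite big_ord_recr/= IH -truncn_ge_nat//.
move: (Num.truncn s) => t {IH s0}; case: (leqP n.+1 t) => h /=; lia.
Qed.

Lemma layer_bounds g n x : 0 <= g x <= 1 ->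
  layer g n x <= g x <= layer g n x + n.+1%:R^-1.
Proof.
move=> /andP[g0 g1]; have n0 : 0 < n.+1%:R :> R by rewrite ltr0n.
have s0 : 0 <= g x * n.+1%:R by rewrite mulr_ge0.
have -> : layer g n x = n.+1%:R^-1 * (Num.truncn (g x * n.+1%:R))%:R.
  rewrite /layer; congr (_ * _).
  have tn : (Num.truncn (g x * n.+1%:R) <= n.+1)%N.
    rewrite -[X in (_ <= X)%N](@natrK R); apply: le_truncn.
    by rewrite ler_piMl.
  rewrite -[in RHS](minn_idPr tn) -(sum_le_nat _ s0) natr_sum.
  apply: eq_bigr => j _; rewrite indicE -ler_pdivrMr//.
  by congr ((nat_of_bool _)%:R); apply/idP/idP; rewrite inE.
have /andP[t1 t2] := truncn_itv s0.
apply/andP; split; first by rewrite ler_pdivrMl// [leRHS]mulrC.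
by rewrite -[X in _ + X]mulr1 -mulrDr ler_pdivlMl// natr1 [leLHS]mulrC ltW.
Qed.

Lemma measurable_level g n j : measurable_fun [set: T] g -> measurable (level g n j).
Proof. exact: measurable_gec. Qed.

End LayerCake.

Section PositiveFormMul.
Context {disp : measure_display} {T : measurableType disp} {R : realType}.
Context {V : zmodType} {w : T -> R} {B : (T -> R) -> V -> V -> R}.
Hypothesis w_ge1 : forall x, 1 <= w x.
Hypothesis pB : positive_form w B.
Local Notation dom := (dominated w).

Lemma form_layer (g : T -> R) n (u v : V) : measurable_fun [set: T] g ->
  B (layer g n) u v = n.+1%:R^-1 * \sum_(j < n.+1) B \1_(level g n j) u v.
Proof.
move=> mg; have dl j : dom \1_(level g n j).
  by apply: dominated_indic => //; exact: measurable_level.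
rewrite (form_scalel pB); first by rewrite (form_suml w_ge1 pB).
by apply: dominated_sum => //; exact: dominated_cst.
Qed.

Variable X : T -> R.
Hypothesis domX : dom X.
Hypothesis domX2 : dom (fun x => X x ^+ 2).
Variables p p' : V.
Hypothesis Hx : B (fun=> 1) p' p' = B X p' p.
Hypothesis Hx2 : B (fun=> 1) p' p' = B (fun x => X x ^+ 2) p p.

Let mX : measurable_fun [set: T] X. Proof. by case: domX. Qed.

Let form_mul01 (q : V) (g : T -> R) (N : nat) : measurable_fun [set: T] g ->
  (forall x, 0 <= g x <= 1) -> (forall x, g x != 0 -> `|X x| < N%:R) ->
  B g q p' = B (fun x => g x * X x) q p.
Proof.
move=> mg g01 gN.
pose S : set T := [set x | `|X x| < N%:R].
have mS : measurable S by apply: measurable_ltc; exact: measurableT_comp.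
have dS : dom \1_S by exact: dominated_indic.
have g0 x : ~ S x -> g x = 0.
  by move=> nS; apply/eqP/negPn/negP => /gN.
have dg : dom g.
  apply: (@dominated_bounded _ _ _ _ w_ge1 _ 1) => // x.
  by have /andP[? ?] := g01 x; rewrite ger0_norm.
have dl n j : dom \1_(level g n j).
  by apply: dominated_indic => //; exact: measurable_level.
have dlay n : dom (layer g n).
  by apply/dominatedZ/dominated_sum => //; exact: dominated_cst.
have domSX f : dom f -> (forall x, ~ S x -> f x = 0) -> dom (fun x => f x * X x).
  move=> df f0; apply: (dominated_le (dominatedZ N%:R df)).
    by apply: measurable_funM => //; case: df.
  move=> x; have [Sx|nSx] := pselect (S x); last by rewrite f0// mul0r mulr0.
  by rewrite !normrM mulrC ler_wpM2r// [leRHS]ger0_norm// ltW.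
have lay0 n x : ~ S x -> layer g n x = 0.
  move=> nS; rewrite /layer big1 ?mulr0// => j _; rewrite indicE memNset//.
  by rewrite /level/= g0// leNgt divr_gt0// ltr0n.
pose D f := B f q p' - B (fun x => f x * X x) q p.
have Dlay n : D (layer g n) = 0.
  rewrite /D form_layer//.
  have -> : (fun x => layer g n x * X x) = (fun x => n.+1%:R^-1 *
      \sum_(j < n.+1) (fun j x => \1_(level g n j) x * X x) j x).
    by apply/funext => x; rewrite /layer -mulrA mulr_suml.
  have dlX j : dom (fun x => \1_(level g n j) x * X x).
    by apply: dominated_indicM => //; exact: measurable_level.
  rewrite (form_scalel pB); last first.
    by apply: dominated_sum => //; exact: dominated_cst.
  rewrite (form_suml w_ge1 pB)// -mulrBr -sumrB big1 ?mulr0// => j _.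
  rewrite (form_mul_indic w_ge1 pB domX domX2 Hx Hx2 q (N := N)) ?subrr//.
    exact: measurable_level.
  move=> x; rewrite /level/= => gx; apply: gN.
  by rewrite gt_eqF// (lt_le_trans _ gx)// divr_gt0// ltr0n.
pose K := (B \1_S q q + B \1_S p' p') + N%:R * (B \1_S q q + B \1_S p p).
suff key n : n.+1%:R * `|D g| <= K.
  apply/eqP; rewrite -subr_eq0 -/(D g) -normr_le0 -oppr_ge0.
  by apply: (@archi_ge0 _ K) => n; rewrite mulrN lerN2.
rewrite -ler_pdivlMl ?ltr0n//; set e := n.+1%:R^-1.
have e0 : 0 < e by rewrite invr_gt0 ltr0n.
pose f x := g x - layer g n x.
have df : dom f.
  have := dominatedD dg (dominatedZ (-1) (dlay n)).
  by congr dominated; apply/funext => x; rewrite mulN1r.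
have f0 x : ~ S x -> f x = 0 by move=> nS; rewrite /f g0// lay0// subr0.
have -> : D g = D f.
  rewrite -[LHS]subr0 -(Dlay n) /D /f (formBl pB)//.
  have -> : (fun x => (g x - layer g n x) * X x) =
      (fun x => g x * X x - layer g n x * X x).
    by apply/funext => x; rewrite mulrBl.
  rewrite (formBl pB); [ring|exact: domSX|apply: domSX => //; exact: lay0].
have fe x : `|f x| <= e * \1_S x.
  rewrite indicE; have [Sx|nSx] := pselect (S x); last first.
    by rewrite f0// normr0 memNset// mulr0.
  rewrite mem_set// mulr1; have /andP[? ?] := layer_bounds n (g01 x).
  by rewrite ger0_norm ?subr_ge0// lerBlDl.
have fXe x : `|f x * X x| <= e * N%:R * \1_S x.
  have [Sx|nSx] := pselect (S x); last first.
    by rewrite f0// mul0r normr0 indicE memNset// mulr0.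
  rewrite normrM mulrAC; apply: ler_pM => //; exact: ltW.
have := form_dominated pB q p' (dominatedZ e dS) df fe.
have := form_dominated pB q p (dominatedZ (e * N%:R) dS) (domSX _ df f0) fXe.
rewrite !(form_scalel pB)// -!mulrDr -/(f) => h1 h2.
have : `|D f| <= `|B f q p'| + `|B (fun x => f x * X x) q p| by exact: ler_normB.
have b1 : 0 <= B \1_S q q by exact: (form_indic_ge0 w_ge1 pB).
have b2 : 0 <= B \1_S p p by exact: (form_indic_ge0 w_ge1 pB).
have b3 : 0 <= B \1_S p' p' by exact: (form_indic_ge0 w_ge1 pB).
have -> : e * K = e * (B \1_S q q + B \1_S p' p') +
    e * N%:R * (B \1_S q q + B \1_S p p) by rewrite /K; ring.
have : 0 <= e * (B \1_S q q + B \1_S p' p') by rewrite mulr_ge0 ?addr_ge0// ltW.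
have : 0 <= e * N%:R * (B \1_S q q + B \1_S p p).
  by rewrite !mulr_ge0 ?addr_ge0// ltW.
by move: (D f) => Df; lra.
Qed.

(** Multiplication by [X] passes from the functional to the vectors, on bounded
    functions supported where [X] is bounded. *)
Lemma form_mul (q : V) (g : T -> R) (M : R) (N : nat) : measurable_fun [set: T] g ->
  (forall x, `|g x| <= M) -> (forall x, g x != 0 -> `|X x| < N%:R) ->
  B g q p' = B (fun x => g x * X x) q p.
Proof.
move=> mg gM gN.
wlog M0 : M gM / 0 < M.
  move=> /(_ (`|M| + 1)); apply; last by rewrite ltr_wpDl.
  move=> x; rewrite (le_trans (gM x))// (le_trans (ler_norm _))// lerDl//.
pose S : set T := [set x | `|X x| < N%:R].
have mS : measurable S by apply: measurable_ltc; exact: measurableT_comp.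
have dS : dom \1_S by exact: dominated_indic.
have dSX : dom (fun x => \1_S x * X x) by exact: dominated_indicM.
(* Reduce to values in [[0, 1]] by an affine change that preserves the support. *)
pose h x := (2 * M)^-1 * (g x + M * \1_S x).
have M2 : 0 < 2 * M by rewrite mulr_gt0.
have g0 x : ~ S x -> g x = 0 by move=> nS; apply/eqP/negPn/negP => /gN.
have mh : measurable_fun [set: T] h.
  apply: measurable_funM => //; apply: measurable_funD => //.
  by apply: measurable_funM => //; exact: measurable_indic.
have h01 x : 0 <= h x <= 1.
  rewrite /h mulr_ge0 ?invr_ge0 ?(ltW M2)//=; last first.
    have [Sx|nSx] := pselect (S x); last by rewrite g0// indicE memNset// mulr0 addr0.
    by rewrite indicE mem_set// mulr1; have := gM x; rewrite ler_norml; lra.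
  rewrite ler_pdivrMl// mulr1.
  have : M * \1_S x <= M by rewrite ler_piMr ?(ltW M0)// indicE lern1 leq_b1.
  by have := gM x; rewrite ler_norml; lra.
have hN x : h x != 0 -> `|X x| < N%:R.
  apply: contra_neqT => /negP nS.
  by rewrite /h g0// indicE memNset// mulr0 addr0 mulr0.
have dg : dom g by exact: (@dominated_bounded _ _ _ _ w_ge1 _ M).
have dgX : dom (fun x => g x * X x).
  apply: (dominated_le (dominatedZ N%:R dg)); first exact: measurable_funM.
  move=> x; have [Sx|nSx] := pselect (S x); last by rewrite g0// mul0r mulr0.
  by rewrite !normrM mulrC ler_wpM2r// [leRHS]ger0_norm// ltW.
have := form_mul01 q mh h01 hN.
have -> : (fun x => h x * X x) =
    (fun x => (2 * M)^-1 * (g x * X x + M * (\1_S x * X x))).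
  by apply/funext => x; rewrite /h; ring.
rewrite /h.
rewrite !(form_scalel pB); try by [apply: dominatedD => //; exact: dominatedZ].
rewrite !(form_addl pB)//; try exact: dominatedZ.
rewrite !(form_scalel pB)// (form_mul_indic w_ge1 pB domX domX2 Hx Hx2 q (N := N))//.
by move=> /mulfI; rewrite invr_eq0 gt_eqF// => /(_ isT) /addIr.
Qed.

End PositiveFormMul.

(** * Monomials, quadratic growth and Riesz representation *)

Section ContinuousRealFunctions.
Context {T : topologicalType} {R : realType}.
Implicit Types f g : T -> R.

Lemma continuous_mul f g :
  continuous f -> continuous g -> continuous (fun x => f x * g x).
Proof. by move=> cf cg x; apply: cvgM; [exact: cf|exact: cg]. Qed.

Lemma continuous_add f g :
  continuous f -> continuous g -> continuous (fun x => f x + g x).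
Proof. by move=> cf cg x; apply: cvgD; [exact: cf|exact: cg]. Qed.

Lemma continuous_sub f g :
  continuous f -> continuous g -> continuous (fun x => f x - g x).
Proof. by move=> cf cg x; apply: cvgB; [exact: cf|exact: cg]. Qed.

Lemma continuous_compR (h : R -> R) f :
  continuous f -> continuous h -> continuous (fun x => h (f x)).
Proof. by move=> cf ch x; exact: (continuous_comp (cf x) (ch (f x))). Qed.

End ContinuousRealFunctions.

Section Monomials.
Variables (R : realType) (d : nat).
Implicit Types (k n : multiindex d) (x : 'rV[R]_d).

(** The multiindex of the [i]-th coordinate function. *)
Definition mdelta (i : 'I_d) : multiindex d := [ffun j => (j == i) : nat].

Lemma xpow0 x : xpow 0 x = 1.
Proof. by rewrite /xpow big1// => i _; rewrite ffunE expr0. Qed.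

Lemma xpowD k n x : xpow (k + n) x = xpow k x * xpow n x.
Proof.
by rewrite /xpow -big_split/=; apply: eq_bigr => i _; rewrite ffunE exprD.
Qed.

Lemma xpow_mdelta i x : xpow (mdelta i) x = x 0 i.
Proof.
rewrite /xpow (bigD1 i)//= big1 ?mulr1 ?ffunE ?eqxx ?expr1// => j /negbTE ji.
by rewrite ffunE ji expr0.
Qed.

Lemma multiindex_ind (P : multiindex d -> Prop) :
  P 0 -> (forall k i, P k -> P (k + mdelta i)) -> forall k, P k.
Proof.
move=> P0 PS k; have [m] := ubnP (absm k); elim: m k => // m IH k km.
have [->//|k0] := eqVneq k 0.
have [i ki] : exists i, (0 < k i)%N.
  apply/existsP; apply: contra_neqT k0 => /existsPn k0.
  by apply/ffunP => i; rewrite ffunE; apply/eqP; rewrite -leqn0 leqNgt k0.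
pose k' : multiindex d := [ffun j => (k j - (j == i))%N].
have kE : k = k' + mdelta i.
  apply/ffunP => j; rewrite !ffunE; case: eqVneq => [->|_]; last first.
    by rewrite subn0 addr0.
  by rewrite [RHS](subnK ki).
rewrite kE; apply/PS/IH; move: km; rewrite ltnS; apply: leq_trans.
rewrite /absm (bigD1 i)//= [in X in (_ < X)%N](bigD1 i)//= -addSn leq_add//.
  by rewrite ffunE eqxx subn1 prednK.
by apply: leq_sum => j _; rewrite ffunE leq_subr.
Qed.

Lemma continuous_borel (g : 'rV[R]_d -> R) :
  continuous g -> measurable_fun [set: Rd R d] g.
Proof.
move=> /continuousP cg.
apply: (measurability _ (RGenOpens.measurableE R)) => _ [_ [a [b ->]] <-].
rewrite setTI; apply: borel_open; apply: cg; exact: interval_open.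
Qed.

Lemma coord_cont (i : 'I_d) : continuous (fun x : 'rV[R]_d => x 0 i).
Proof. exact: coord_continuous. Qed.

Lemma xpow_continuous n : continuous (xpow n : 'rV[R]_d -> R).
Proof.
elim/multiindex_ind: n => [|k i ck].
  have -> : xpow 0 = (fun=> 1) :> ('rV[R]_d -> R).
    by apply/funext => x; rewrite xpow0.
  exact: cst_continuous.
have -> : xpow (k + mdelta i) = (fun x => xpow k x * x 0 i) :> ('rV[R]_d -> R).
  by apply/funext => x; rewrite xpowD xpow_mdelta.
by apply: continuous_mul => //; exact: coord_cont.
Qed.

Lemma xpow_borel n : measurable_fun [set: Rd R d] (xpow n).
Proof. by apply: continuous_borel; exact: xpow_continuous. Qed.

Lemma coord_borel i : measurable_fun [set: Rd R d] (fun x => x 0 i : R).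
Proof. by apply: continuous_borel; exact: coord_cont. Qed.

(** The functions of quadratic growth are those dominated by [weight]. *)
Definition weight (x : Rd R d) : R := 1 + \sum_(i < d) x 0 i ^+ 2.

Lemma weight_ge1 (x : Rd R d) : 1 <= weight x.
Proof. by rewrite /weight lerDl sumr_ge0// => i _; exact: sqr_ge0. Qed.

Lemma coord_sqr_le_weight i (x : Rd R d) : x 0 i ^+ 2 <= weight x.
Proof.
rewrite /weight (bigD1 i)//= addrCA lerDl addr_ge0// sumr_ge0// => j _.
exact: sqr_ge0.
Qed.

Lemma weight_borel : measurable_fun [set: Rd R d] weight.
Proof.
apply: measurable_funD => //; apply: measurable_sum => i.
by apply: measurable_funX; exact: coord_borel.
Qed.

Lemma dominated_weight : dominated weight weight.
Proof.
split; first exact: weight_borel.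
by exists 1 => x; rewrite mul1r ger0_norm// (le_trans ler01)// weight_ge1.
Qed.

Lemma dominated_coord_sqr i : dominated weight (fun x => x 0 i ^+ 2).
Proof.
apply: (dominated_le dominated_weight).
  by apply: measurable_funX; exact: coord_borel.
move=> x; rewrite !ger0_norm ?sqr_ge0 ?coord_sqr_le_weight//.
by rewrite (le_trans ler01)// weight_ge1.
Qed.

Lemma dominated_coord i : dominated weight (fun x => x 0 i).
Proof.
apply: (dominated_le dominated_weight); first exact: coord_borel.
move=> x; rewrite [leRHS]ger0_norm; last by rewrite (le_trans ler01)// weight_ge1.
have [x1|x1] := leP `|x 0 i| 1; first by rewrite (le_trans x1)// weight_ge1.
rewrite (le_trans _ (coord_sqr_le_weight i x))// -(real_normK (num_real _)) expr2.
by rewrite ler_peMl// ltW.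
Qed.

End Monomials.

Section Riesz.
Variables (R : realType) (d : nat) (V : zmodType).
Variable B : (Rd R d -> R) -> V -> V -> R.
Hypothesis pB : positive_form (@weight R d) B.
Variable u : V.
Local Notation w1 := (@weight_ge1 R d).

Let N (A : set (Rd R d)) : R := B \1_A u u.

Let N_ge0 A : measurable A -> 0 <= N A.
Proof. by move=> mA; rewrite /N; exact: (form_indic_ge0 w1 pB). Qed.

Let N_add A C : measurable A -> measurable C -> A `&` C = set0 ->
  N (A `|` C) = N A + N C.
Proof. by move=> mA mC AC; rewrite /N; exact: (form_indicU w1 pB). Qed.

(** The compact cubes exhaust the content, by a Chebyshev bound on the square
    of the coordinates. *)
Let N_tight e : 0 < e -> exists2 K : set 'rV[R]_d, compact K & N (~` K) <= e.
Proof.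
move=> e0; pose n := Num.truncn (B (@weight R d) u u / e).
pose r : R := n.+1%:R.
pose K : set 'rV[R]_d := [set v | forall i, `[- r, r]%classic (v ord0 i)].
have cK : compact K.
  apply: (@rV_compact _ _ (fun=> `[- r, r]%classic)) => _.
  exact: segment_compact.
exists K => //.
have r0 : 0 < r by rewrite ltr0n.
have r1 : 1 <= r by rewrite ler1n.
have mK : measurable (~` K : set (Rd R d)).
  by apply: measurableC; exact: borel_compact.
have : N (~` K) <= r^-1 * B (@weight R d) u u.
  rewrite -(form_scalel pB); last exact: dominated_weight.
  apply: (le_form pB); first by apply: (dominated_indic w1).
    exact: dominatedZ (dominated_weight R d).
  move=> x; rewrite ler_pdivlMl// indicE.
  have [/set_mem xK|_] := boolP (x \in _); last by rewrite mulr0 (le_trans ler01)// w1.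
  rewrite mulr1 leNgt; apply/negP => wr; apply: xK => i /=.
  rewrite in_itv/= -ler_norml leNgt; apply/negP => rx; move: wr; apply/negP.
  rewrite -leNgt (le_trans _ (coord_sqr_le_weight i x))// -(real_normK (num_real _)).
  by rewrite expr2 (le_trans (ltW rx))// ler_peMl// (le_trans r1)// ltW.
move=> /le_trans; apply; rewrite ler_pdivrMl// mulrC -ler_pdivrMl// mulrC.
exact/ltW/truncnS_gt.
Qed.

(** Riesz representation: the diagonal value of a positive form at [u] is an
    integral on bounded continuous functions. *)
Lemma riesz : exists mu : {measure set (Rd R d) -> \bar R},
  (mu setT < +oo)%E /\
  forall (g : 'rV[R]_d -> R) (M : R), continuous g -> (forall x, `|g x| <= M) ->
    (\int[mu]_x (g x)%:E = (B g u u)%:E)%E.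
Proof.
have [mu [muT muo]] := content_regularization N_ge0 N_add N_tight.
have mufin (A : set (Rd R d)) : measurable A -> mu A \is a fin_num.
  move=> mA; rewrite ge0_fin_numE//; apply: (@le_lt_trans _ _ (mu setT)).
    by apply: le_measure; rewrite ?inE.
  by rewrite muT ltry.
have muc (C : set 'rV[R]_d) : closed C -> ((N C)%:E <= mu C)%E.
  move=> cC; have mC := borel_closed cC.
  have mC' : measurable (~` C : set (Rd R d)) by exact: measurableC.
  have := muo _ (closed_openC cC).
  have : mu setT = (mu C + mu (~` C))%E.
    by rewrite -measureU ?setUv// setICr.
  have : N setT = N C + N (~` C) by rewrite -N_add ?setUv// setICr.
  rewrite muT => ->.
  have /fineK <- := mufin _ mC; have /fineK <- := mufin _ mC'.
  by rewrite -EFinD !lee_fin => -[h1] h2; lra.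
exists mu; split; first by rewrite muT ltry.
have intg (g : 'rV[R]_d -> R) (M : R) : continuous g -> (forall x, `|g x| <= M) ->
    mu.-integrable setT (EFin \o g).
  move=> cg gM; apply: measurable_bounded_integrable => //.
  - by rewrite muT ltry.
  - exact: continuous_borel.
  - by exists M; split; [exact: num_real|move=> y My x _; exact: le_trans (gM x) (ltW My)].
have domg (g : 'rV[R]_d -> R) (M : R) : continuous g -> (forall x, `|g x| <= M) ->
    dominated (@weight R d) g.
  move=> cg gM; apply: (@dominated_bounded _ _ _ _ w1 g M) => //.
  exact: continuous_borel.
(* Closed sets gain mass under regularization, which gives one inequality;
   applying it to [1 - g] gives the other one. *)
have lower (g : Rd R d -> R) : continuous (g : 'rV[R]_d -> R) -> (forall x, 0 <= g x <= 1) ->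
    B g u u <= \int[mu]_x g x.
  move=> cg g01.
  have gM x : `|g x| <= 1 by have /andP[? ?] := g01 x; rewrite ger0_norm.
  have mg := continuous_borel cg.
  have dl n j : dominated (@weight R d) \1_(level g n j).
    by apply: dominated_indic; [exact: w1|exact: measurable_level].
  have dlay n : dominated (@weight R d) (layer g n).
    apply/dominatedZ/dominated_sum => //; exact: dominated_cst w1 _.
  rewrite -subr_ge0; apply: (@archi_ge0 _ (B (fun=> 1) u u)) => n.
  rewrite lerNl -mulrN opprB -ler_pdivlMl ?ltr0n// lerBlDl.
  have : B g u u <= B (layer g n) u u + n.+1%:R^-1 * B (fun=> 1) u u.
    have d1 : dominated (@weight R d) (fun=> 1) by exact: dominated_cst w1 _.
    rewrite -(form_scalel pB)// -(form_addl pB)//; last exact: dominatedZ.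
    apply: (le_form pB); [exact: domg gM|exact/dominatedD/dominatedZ|].
    by move=> x; rewrite mulr1; have /andP[] := layer_bounds n (g01 x).
  move=> /le_trans; apply; rewrite lerD2r.
  rewrite -lee_fin /Rintegral fineK; last first.
    by apply: integrable_fin_num => //; exact: intg gM.
  apply: (@le_trans _ _ (\int[mu]_x (layer g n x)%:E)%E); last first.
    apply: ge0_le_integral => //.
    - by move=> x _; rewrite lee_fin /layer mulr_ge0 ?invr_ge0// sumr_ge0.
    - by have /measurable_EFinP := (dlay n).1.
    - by have /measurable_EFinP := mg.
    - by move=> x _; rewrite lee_fin; have /andP[] := layer_bounds n (g01 x).
  rewrite (form_layer w1 pB)//.
  under eq_integral do rewrite /layer EFinM -sumEFin.
  rewrite ge0_integralZl//; first last.
  - by move=> x _; rewrite sume_ge0// => j _; rewrite lee_fin indicE.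
  - apply: emeasurable_sum => j.
    by have /measurable_EFinP := (dl n j).1.
  rewrite ge0_integral_sum//; first last.
  - by move=> j; have /measurable_EFinP := (dl n j).1.
  rewrite EFinM -sumEFin; apply: lee_wpmul2l; first by rewrite lee_fin invr_ge0.
  apply: lee_sum => j _; rewrite integral_indic ?setIT//; last exact: measurable_level.
  apply: muc; rewrite /level.
  by have /continuous_closedP/(_ _ (@closed_ge _ (j.+1%:R / n.+1%:R))) := cg.
have T1 : B (fun=> 1) u u = fine (mu setT).
  by rewrite muT/= /N indicT.
have eq01 (g : 'rV[R]_d -> R) : continuous g -> (forall x, 0 <= g x <= 1) ->
    B g u u = \int[mu]_x g x.
  move=> cg g01; apply/eqP; rewrite eq_le lower//=.
  have gM x : `|g x| <= 1 by have /andP[? ?] := g01 x; rewrite ger0_norm.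
  have c1 : continuous (fun x => 1 - g x).
    by apply: continuous_sub => //; exact: cst_continuous.
  have /(lower _ c1) : forall x, 0 <= 1 - g x <= 1.
    by move=> x; have := g01 x; lra.
  rewrite (formBl pB); [|exact: dominated_cst w1 _|exact: domg gM].
  have i1 : mu.-integrable setT (EFin \o (fun=> 1)).
    by apply: (intg _ 1) => [|x]; [exact: cst_continuous|rewrite normr1].
  rewrite (RintegralB _ i1 (intg _ _ cg gM))//.
  by rewrite Rintegral_cst// mul1r T1; lra.
move=> g M cg gM.
wlog M0 : M gM / 0 < M.
  move=> /(_ (`|M| + 1)); apply; last by rewrite ltr_wpDl.
  by move=> x; rewrite (le_trans (gM x))// (le_trans (ler_norm _))// lerDl.
have M2 : 0 < 2 * M by rewrite mulr_gt0.
have c1 : continuous (fun x => (2 * M)^-1 * (g x + M)).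
  apply: continuous_mul; first exact: cst_continuous.
  by apply: continuous_add => //; exact: cst_continuous.
have /(eq01 _ c1) : forall x, 0 <= (2 * M)^-1 * (g x + M) <= 1.
  move=> x; have := gM x; rewrite ler_norml => /andP[h1 h2].
  rewrite mulr_ge0 ?invr_ge0 ?(ltW M2)//=; last lra.
  by rewrite ler_pdivrMl//; lra.
have dM : dominated (@weight R d) (fun=> M) by exact: dominated_cst w1 _.
have iM : mu.-integrable setT (EFin \o (fun=> M)).
  by apply: (intg _ M) => [|x]; [exact: cst_continuous|rewrite gtr0_norm].
have ig := intg _ _ cg gM; have dg := domg _ _ cg gM.
rewrite (form_scalel pB _ _ _ (dominatedD dg dM)) (form_addl pB _ _ dg dM).
rewrite RintegralZl//; last exact: (integrableD measurableT ig iM).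
rewrite RintegralD//.
move=> /mulfI; rewrite invr_eq0 gt_eqF// => /(_ isT).
rewrite Rintegral_cst// -T1.
have -> : B (fun=> M) u u = M * B (fun=> 1) u u.
  rewrite -(form_scalel pB); last exact: dominated_cst w1 _.
  by congr (B _ u u); apply/funext => x; rewrite mulr1.
move=> /addIr ->; rewrite /Rintegral fineK//.
by apply: integrable_fin_num => //; exact: intg gM.
Qed.

End Riesz.

(** * Representing measures of positive forms *)

Section Cutoff.
Variables (R : realType) (d : nat).

(** The piecewise linear retraction of the line onto [[0, 1]]. *)
Definition clamp (t : R) : R := (1 + `|t| - `|t - 1|) / 2.

Lemma clamp_ge0 t : 0 <= clamp t.
Proof. by rewrite /clamp; case: (ger0P t); case: (ger0P (t - 1)); lra. Qed.

Lemma clamp_le1 t : clamp t <= 1.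
Proof. by rewrite /clamp; case: (ger0P t); case: (ger0P (t - 1)); lra. Qed.

Lemma clamp1 t : 1 <= t -> clamp t = 1.
Proof. by rewrite /clamp; case: (ger0P t); case: (ger0P (t - 1)); lra. Qed.

Lemma clamp0 t : t <= 0 -> clamp t = 0.
Proof. by rewrite /clamp; case: (ger0P t); case: (ger0P (t - 1)); lra. Qed.

Lemma le_clamp s t : s <= t -> clamp s <= clamp t.
Proof.
by rewrite /clamp; case: (ger0P t); case: (ger0P (t - 1)); case: (ger0P s);
  case: (ger0P (s - 1)); lra.
Qed.

Lemma clamp_continuous : continuous clamp.
Proof.
apply: continuous_mul; last exact: cst_continuous.
apply: continuous_sub.
  apply: continuous_add; first exact: cst_continuous.
  exact: norm_continuous.
apply: (@continuous_compR _ _ (fun u : R => `|u|)); last exact: norm_continuous.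
by apply: continuous_sub; [move=> ?; exact: cvg_id|exact: cst_continuous].
Qed.

(** Continuous cutoffs supported in increasing cubes. *)
Definition cutoff n (x : Rd R d) : R := clamp (n.+2%:R - weight x).

Lemma weight_continuous : continuous (@weight R d : 'rV[R]_d -> R).
Proof.
apply: continuous_add; first exact: cst_continuous.
have E (s : seq 'I_d) : continuous (fun x : 'rV[R]_d => \sum_(i <- s) x 0 i ^+ 2).
  elim: s => [|i s IH].
    by under eq_fun do rewrite big_nil; exact: cst_continuous.
  under eq_fun do rewrite big_cons.
  apply: continuous_add => //; under eq_fun do rewrite expr2.
  by apply: continuous_mul; exact: coord_cont.
exact: E.
Qed.

Lemma cutoff_continuous n : continuous (cutoff n : 'rV[R]_d -> R).
Proof.
apply: (@continuous_compR _ _ clamp); last exact: clamp_continuous.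
by apply: continuous_sub; [exact: cst_continuous|exact: weight_continuous].
Qed.

Lemma cutoff_ge0 n x : 0 <= cutoff n x. Proof. exact: clamp_ge0. Qed.

Lemma cutoff_le1 n x : cutoff n x <= 1. Proof. exact: clamp_le1. Qed.

Lemma cutoff_norm n x : `|cutoff n x| <= 1.
Proof. by rewrite ger0_norm ?cutoff_ge0 ?cutoff_le1. Qed.

Lemma cutoff_supp n x i : cutoff n x != 0 -> `|x 0 i| < n.+1%:R.
Proof.
apply: contra_neqT; rewrite -leNgt => nx; apply: clamp0.
rewrite subr_le0 -natr1 addrC /weight lerD2l (bigD1 i)//=.
rewrite (le_trans nx)// (@le_trans _ _ (x 0 i ^+ 2))//.
  rewrite -(real_normK (num_real (x 0 i))) expr2 ler_peMl//.
  by rewrite (le_trans _ nx)// ler1n.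
by rewrite lerDl sumr_ge0// => j _; exact: sqr_ge0.
Qed.

Lemma cutoff_tail n x : 1 - cutoff n x <= n.+1%:R^-1 * weight x.
Proof.
have w0 : 0 <= weight x by rewrite (le_trans ler01)// weight_ge1.
have [wn|nw] := leP (weight x) n.+1%:R.
  rewrite /cutoff clamp1 ?subrr ?mulr_ge0 ?invr_ge0//.
  by rewrite lerBrDr -[n.+2%:R]natr1 addrC lerD2r.
apply: (@le_trans _ _ 1); first by rewrite lerBlDr lerDl cutoff_ge0.
by rewrite ler_pdivlMl ?ltr0n// mulr1 ltW.
Qed.

Lemma le_cutoff n m x : (n <= m)%N -> cutoff n x <= cutoff m x.
Proof. by move=> nm; apply: le_clamp; rewrite lerD2r ler_nat ltnS. Qed.

Lemma cutoff_eventually1 x : \forall n \near \oo, cutoff n x = 1.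
Proof.
exists (Num.truncn (weight x)) => // n /= tn; apply: clamp1.
rewrite lerBrDr -[n.+2%:R]natr1 addrC lerD2r (le_trans (ltW (truncnS_gt _)))//.
by rewrite ler_nat ltnS.
Qed.

Lemma xpow_bounded (k : multiindex d) (r : R) : exists C : R,
  forall x : 'rV[R]_d, (forall i, `|x 0 i| <= r) -> `|xpow k x| <= C.
Proof.
elim/multiindex_ind: k => [|k i [C IH]].
  by exists 1 => x _; rewrite xpow0 normr1.
exists (C * r) => x xr; rewrite xpowD xpow_mdelta normrM.
by apply: ler_pM => //; exact: IH.
Qed.

End Cutoff.

(** A positive form whose values at [1], [x_i] and [x_i ^ 2] on the monomial
    vectors are shifted terms of one multisequence [al] yields a representing
    measure for [al]. *)
Section MomentsOfForm.
Variables (R : realType) (d : nat) (V : zmodType).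
Variable B : (Rd R d -> R) -> V -> V -> R.
Hypothesis pB : positive_form (@weight R d) B.
Variables (E : multiindex d -> V) (al : multiindex d -> R).
Hypothesis B1 : forall k l, B (fun=> 1) (E k) (E l) = al (k + l).
Hypothesis BX : forall k l i,
  B (fun x => x 0 i) (E k) (E l) = al (mdelta i + k + l).
Hypothesis BX2 : forall k l i,
  B (fun x => x 0 i ^+ 2) (E k) (E l) = al (mdelta i + mdelta i + k + l).

Local Notation w1 := (@weight_ge1 R d).

(** On bounded functions supported in a cube, multiplication by a monomial passes
    from the functional to the vectors. *)
Lemma form_monomial k (g : Rd R d -> R) (M : R) (N : nat) :
  measurable_fun [set: Rd R d] g -> (forall x, `|g x| <= M) ->
  (forall x i, g x != 0 -> `|x 0 i| < N%:R) ->
  B g (E 0) (E k) = B (fun x => g x * xpow k x) (E 0) (E 0).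
Proof.
elim/multiindex_ind: k g M => [|k i IH] g M mg gM gN.
  by congr (B _ _ _); apply/funext => x; rewrite xpow0 mulr1.
have hx : B (fun=> 1) (E (k + mdelta i)) (E (k + mdelta i)) =
    B (fun x => x 0 i) (E (k + mdelta i)) (E k).
  by rewrite B1 BX; congr al; rewrite [mdelta i + _]addrC addrA addrAC.
have hx2 : B (fun=> 1) (E (k + mdelta i)) (E (k + mdelta i)) =
    B (fun x => x 0 i ^+ 2) (E k) (E k).
  rewrite B1 BX2; congr al; rewrite -[RHS]addrA [RHS]addrC addrACA.
  by rewrite [in RHS]addrC addrC.
rewrite (form_mul w1 pB (@dominated_coord R d i) (@dominated_coord_sqr R d i)
  hx hx2 (E 0) mg gM (fun x => gN x i)).
rewrite (IH _ (M * N%:R)).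
- by congr (B _ _ _); apply/funext => x; rewrite xpowD xpow_mdelta mulrAC -mulrA.
- by apply: measurable_funM => //; exact: coord_borel.
- move=> x; rewrite normrM; have [->|g0] := eqVneq (g x) 0.
    by rewrite normr0 mul0r mulr_ge0// (le_trans _ (gM x)).
  by apply: ler_pM => //; apply/ltW/gN.
- by move=> x j gx; apply: gN; apply: contra_neq gx => ->; rewrite mul0r.
Qed.

Let dcut n : dominated (@weight R d) (cutoff n).
Proof.
apply: (dominated_bounded w1 _ (@cutoff_norm _ _ n)).
by apply: continuous_borel; exact: cutoff_continuous.
Qed.

Lemma form_cutoff_cvg k :
  (B (fun x => cutoff n x * xpow k x) (E 0) (E 0)) @[n --> \oo] --> al k.
Proof.
have BE n : B (fun x => cutoff n x * xpow k x) (E 0) (E 0) = B (cutoff n) (E 0) (E k).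
  rewrite (@form_monomial k _ 1 n.+1)//.
  - by case: (dcut n).
  - exact: cutoff_norm.
  - by move=> x i; exact: cutoff_supp.
under eq_fun do rewrite BE.
have -> : al k = B (fun=> 1) (E 0) (E k) by rewrite B1 add0r.
pose K := B (@weight R d) (E 0) (E 0) + B (@weight R d) (E k) (E k).
have K0 : 0 <= K.
  by rewrite addr_ge0//; apply: (form_ge0 pB); [exact: dominated_weight| |exact: dominated_weight|];
    move=> x; rewrite (le_trans ler01)// weight_ge1.
apply/cvgrPdist_le => e e0; exists (Num.truncn (K / e)) => // n /= ne.
have d1 : dominated (@weight R d) (fun=> 1) by exact: dominated_cst w1 _.
have dw : dominated (@weight R d) (fun x => n.+1%:R^-1 * weight x).
  by apply: dominatedZ; exact: dominated_weight.
have dc : dominated (@weight R d) (fun x => 1 - cutoff n x).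
  have := dominatedD d1 (dominatedZ (-1) (dcut n)).
  by congr dominated; apply/funext => x; rewrite mulN1r.
rewrite -(formBl pB)//.
have bnd (x : Rd R d) : `|1 - cutoff n x| <= n.+1%:R^-1 * weight x.
  by rewrite ger0_norm ?subr_ge0 ?cutoff_le1// cutoff_tail.
have := form_dominated pB (E 0) (E k) dw dc bnd.
rewrite !(form_scalel pB); [|exact: dominated_weight..].
rewrite -mulrDr -/K mulr_natl mulr2n => h.
have : `|B (fun x => 1 - cutoff n x) (E 0) (E k)| <= n.+1%:R^-1 * K.
  by rewrite (le_trans _ h)// lerDl.
move=> /le_trans; apply; rewrite ler_pdivrMl ?ltr0n// mulrC -ler_pdivrMl// mulrC.
by rewrite (le_trans (ltW (truncnS_gt _)))// ler_nat ltnS.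
Qed.

Lemma moments_of_form : exists mu : {measure set (Rd R d) -> \bar R},
  forall k, mu.-integrable setT (EFin \o xpow k) /\
            al k = \int[mu]_x xpow k x.
Proof.
have [mu [muT muE]] := riesz pB (E 0).
exists mu.
pose f k n (x : Rd R d) := cutoff n x * xpow k x.
have cf k n : continuous (f k n : 'rV[R]_d -> R).
  apply: (@continuous_mul 'rV[R]_d R (cutoff n) (xpow k)).
    exact: cutoff_continuous.
  exact: xpow_continuous.
have fI k n : (\int[mu]_x (f k n x)%:E = (B (f k n) (E 0) (E 0))%:E)%E.
  have [C xC] := xpow_bounded k (n.+1%:R : R).
  apply: (muE (f k n) `|C| (cf k n)) => x; rewrite /f.
  have [->|c0] := eqVneq (cutoff n x) 0; first by rewrite mul0r normr0.
  rewrite normrM -[leRHS]mul1r; apply: ler_pM => //; first exact: cutoff_norm.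
  rewrite (le_trans (xC _ _)) ?ler_norm// => i; apply/ltW; exact: cutoff_supp.
have fcvg k : (\int[mu]_x (f k n x)%:E)%E @[n --> \oo] --> (al k)%:E.
  under eq_fun do rewrite fI; apply/cvg_EFin; first by near=> n.
  exact: form_cutoff_cvg.
have flim k x : (f k n x)%:E @[n --> \oo] --> (xpow k x)%:E.
  apply: cvg_near_cst; near=> n; rewrite /f.
  have -> : cutoff n x = 1 by near: n; exact: cutoff_eventually1.
  by rewrite mul1r.
have mf k n : measurable_fun [set: Rd R d] (fun x => (f k n x)%:E).
  by have /measurable_EFinP := continuous_borel (cf k n).
have mxpow k : measurable_fun [set: Rd R d] (fun x => (xpow k x)%:E).
  by have /measurable_EFinP := @xpow_borel R d k.
have sq0 k x : 0 <= xpow (k + k) x :> R by rewrite xpowD -expr2 sqr_ge0.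
have evenI k : mu.-integrable setT (EFin \o xpow (k + k)).
  apply/integrableP; split; first exact: mxpow.
  under eq_integral do rewrite /= ger0_norm//.
  have lim := @cvg_monotone_convergence _ _ _ mu setT measurableT
    (fun n x => (f (k + k) n x)%:E) (mf _) _ _.
  have L : (\int[mu]_x (f (k + k) n x)%:E)%E @[n --> \oo] -->
      (\int[mu]_x (xpow (k + k) x)%:E)%E.
    rewrite (_ : (\int[mu]_x (xpow (k + k) x)%:E)%E = (\int[mu]_x
        (limn (fun n => (f (k + k) n x)%:E)))%E); last first.
      by apply: eq_integral => x _; apply/esym/cvg_lim => //; exact: flim.
    apply: lim => [n x _|x _ m n mn].
      by rewrite lee_fin mulr_ge0// cutoff_ge0.
    by rewrite lee_fin; apply: ler_wpM2r => //; exact: le_cutoff.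
  by rewrite (cvg_unique (@ereal_hausdorff R) L (fcvg (k + k))) ltry.
(* The even monomials dominate the others. *)
move=> k.
have i1 : mu.-integrable setT (EFin \o (fun=> 1)).
  apply: measurable_bounded_integrable => //.
  by exists 1; split => // y y1 x _; rewrite /= normr1 ltW.
have [] := @dominated_convergence _ _ _ mu setT measurableT
  (fun n x => (f k n x)%:E) (fun x => (xpow k x)%:E)
  (fun x => (1 + xpow (k + k) x)%:E) (mf _) (mxpow _) _ _ _.
- by apply: aeW => x _; exact: flim.
- exact: (integrableD measurableT i1 (evenI k)).
- apply: aeW => x n _; rewrite lee_fin /f normrM.
  apply: (@le_trans _ _ `|xpow k x|); first by rewrite ler_piMl// cutoff_norm.
  rewrite xpowD -expr2 -(real_normK (num_real (xpow k x))).
  by have := sqr_ge0 (`|xpow k x| - 1); set y := `|_|; nra.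
move=> iX _ cX; split => //.
apply/EFin_inj; rewrite /Rintegral fineK ?integrable_fin_num//.
exact: (cvg_unique (@ereal_hausdorff R) (fcvg k) cX).
Unshelve. all: by end_near. Qed.

End MomentsOfForm.

(** * The hermitian form of a multisequence *)

Section HermitianForm.
Variables (R : realType) (d : nat) (a : multiindex d -> R[i]).
Implicit Types (n k l : multiindex d) (xi eta : Xi R d).

(** The sesquilinear form whose diagonal values are [axi a xi n]. *)
Definition sesq n xi eta : R[i] :=
  \sum_(k <- msupp xi) \sum_(l <- msupp eta)
    a (n + k + l) * mcoeff k xi * (mcoeff l eta)^*%C.

(** The unit vector corresponding to the monomial [x^k]. *)
Definition mon_vec k : Xi R d := mkmalgU k 1.

Lemma msum_incl (D : {fset multiindex d}) (F : multiindex d -> R[i] -> R[i]) xi :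
  (forall k, F k 0 = 0) -> (msupp xi `<=` D)%fset ->
  \sum_(k <- msupp xi) F k (mcoeff k xi) = \sum_(k <- D) F k (mcoeff k xi).
Proof.
move=> F0 sub; apply: big_fset_incl => // k _ /mcoeff_outdom ->.
exact: F0.
Qed.

Lemma msum_add (F : multiindex d -> R[i] -> R[i]) xi eta :
  (forall k x y, F k (x + y) = F k x + F k y) ->
  \sum_(k <- msupp (xi + eta)) F k (mcoeff k (xi + eta)) =
  \sum_(k <- msupp xi) F k (mcoeff k xi) +
  \sum_(k <- msupp eta) F k (mcoeff k eta).
Proof.
move=> FD; have F0 k : F k 0 = 0.
  by have := FD k 0 0; rewrite addr0 -[LHS]addr0 => /addrI.
rewrite (msum_incl F0 (msuppD_le xi eta)).
rewrite (msum_incl F0 (fsubsetUl (msupp xi) (msupp eta))).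
rewrite (msum_incl F0 (fsubsetUr (msupp xi) (msupp eta))) -big_split/=.
by apply: eq_bigr => k _; rewrite mcoeffD FD.
Qed.

Lemma sesqDl n xi xi' eta : sesq n (xi + xi') eta = sesq n xi eta + sesq n xi' eta.
Proof.
apply: (@msum_add (fun k x => \sum_(l <- msupp eta)
  a (n + k + l) * x * (mcoeff l eta)^*%C)) => k x y.
by rewrite -big_split/=; apply: eq_bigr => l _; rewrite mulrDr mulrDl.
Qed.

Lemma sesqDr n xi eta eta' : sesq n xi (eta + eta') = sesq n xi eta + sesq n xi eta'.
Proof.
rewrite /sesq -big_split/=; apply: eq_bigr => k _.
apply: (@msum_add (fun l y => a (n + k + l) * mcoeff k xi * y^*%C)) => l x y.
by rewrite rmorphD/= mulrDr.
Qed.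

Lemma sesqNr n xi eta : sesq n xi (- eta) = - sesq n xi eta.
Proof.
apply/eqP; rewrite -addr_eq0 -sesqDr addNr /sesq big1// => k _.
by rewrite msupp0 big_seq_fset0.
Qed.

Lemma sesqNl n xi eta : sesq n (- xi) eta = - sesq n xi eta.
Proof.
apply/eqP; rewrite -addr_eq0 -sesqDl addNr /sesq.
by rewrite msupp0 big_seq_fset0.
Qed.

Lemma sesq_mono n k l : sesq n (mon_vec k) (mon_vec l) = a (n + k + l).
Proof.
rewrite /sesq /mon_vec !msuppU oner_eq0 !big_seq_fset1 !mcoeffUU mulr1.
by rewrite rmorph1 mulr1.
Qed.

Lemma ReD (x y : R[i]) : complex.Re (x + y) = complex.Re x + complex.Re y.
Proof. by case: x y => [? ?] [? ?]. Qed.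

Lemma ReB (x y : R[i]) : complex.Re (x - y) = complex.Re x - complex.Re y.
Proof. by case: x y => [? ?] [? ?]. Qed.

(** The moment of index [n] required of [mu xi], as a real quadratic form in
    [xi]. *)
Definition quad n xi : R := complex.Re (axi a xi n).

Lemma quad_parallelogram n xi eta :
  quad n (xi + eta) + quad n (xi - eta) = 2 * quad n xi + 2 * quad n eta.
Proof.
rewrite /quad -ReD.
suff -> : axi a (xi + eta) n + axi a (xi - eta) n =
  axi a xi n + axi a xi n + (axi a eta n + axi a eta n).
  by rewrite !ReD; ring.
rewrite -[axi a (xi + eta) n]/(sesq n _ _) -[axi a (xi - eta) n]/(sesq n _ _).
rewrite -[axi a xi n]/(sesq n _ _) -[axi a eta n]/(sesq n _ _).
by rewrite !(sesqDl, sesqDr, sesqNl, sesqNr); ring.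
Qed.

Lemma quad_mono n k l :
  quad n (mon_vec k + mon_vec l) - quad n (mon_vec k - mon_vec l) = 4 * complex.Re (a (n + k + l)).
Proof.
rewrite /quad -ReB.
have -> : axi a (mon_vec k + mon_vec l) n - axi a (mon_vec k - mon_vec l) n =
    a (n + k + l) + a (n + k + l) + (a (n + k + l) + a (n + k + l)).
  rewrite -[axi a (mon_vec k + mon_vec l) n]/(sesq n _ _).
  rewrite -[axi a (mon_vec k - mon_vec l) n]/(sesq n _ _).
  rewrite !(sesqDl, sesqDr, sesqNl, sesqNr) !sesq_mono [n + l + k]addrAC; ring.
by rewrite !ReD; ring.
Qed.

End HermitianForm.

(** * From a convex family of measures to a positive form *)

Section FormOfFamily.
Variables (R : realType) (d : nat) (a : multiindex d -> R[i]).
Variable mu : Xi R d -> {measure set (Rd R d) -> \bar R}.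
Hypothesis mu_moment : forall (xi : Xi R d) (n : multiindex d),
  (N1 d `|` twoN1 d) n -> has_moment (mu xi) n (axi a xi n).
Hypothesis mu_convex : forall (xi eta : Xi R d) (A : set (Rd R d)),
  measurable A ->
  (0 <= mu (xi + eta)%R A + mu (xi - eta)%R A - 2%:E * mu eta A)%E.

Implicit Types (xi eta u v : Xi R d) (g : Rd R d -> R).
Local Notation dom := (dominated (@weight R d)).
Local Notation w1 := (@weight_ge1 R d).

Lemma absm0 : absm (0 : multiindex d) = 0%N.
Proof. by rewrite /absm big1// => i _; rewrite ffunE. Qed.

Lemma absm_mdelta (i : 'I_d) : absm (mdelta i) = 1%N.
Proof.
rewrite /absm (bigD1 i)//= ffunE eqxx big1 ?addn0// => j /negbTE ji.
by rewrite ffunE ji.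
Qed.

Let mem0 : (N1 d `|` twoN1 d) 0.
Proof. by left; rewrite /N1/= absm0. Qed.

Let mem2 i : (N1 d `|` twoN1 d) (mdelta i + mdelta i).
Proof. by right; exists (mdelta i); rewrite ?mulr2n// /N1/= absm_mdelta. Qed.

(** The integral of [g] against the member [mu xi] of the family. *)
Definition int_mu g xi : R := \int[mu xi]_x g x.

Lemma int_mu_quad xi n : (N1 d `|` twoN1 d) n -> int_mu (xpow n) xi = quad a n xi.
Proof. by move=> /(mu_moment xi)[_]; rewrite /quad => ->. Qed.

Lemma integrable1 xi : (mu xi).-integrable setT (EFin \o (fun=> 1)).
Proof.
have [+ _] := mu_moment xi mem0; congr (integrable _ _ _).
by apply/funext => x; rewrite /= xpow0.
Qed.

Lemma mu_fin xi (A : set (Rd R d)) : measurable A -> mu xi A \is a fin_num.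
Proof.
move=> mA; rewrite ge0_fin_numE//; apply: (@le_lt_trans _ _ (mu xi setT)).
  by apply: le_measure; rewrite ?inE.
have /integrableP[_] := integrable1 xi.
by under eq_integral do rewrite /= normr1; rewrite integral_cst// mul1e.
Qed.

Lemma integrable_weight xi : (mu xi).-integrable setT (EFin \o @weight R d).
Proof.
have E (s : seq 'I_d) : (mu xi).-integrable setT
    (EFin \o (fun x : Rd R d => \sum_(i <- s) x 0 i ^+ 2)).
  elim: s => [|i s IH].
    have := integrableZl measurableT 0 (integrable1 xi).
    by congr (integrable _ _ _); apply/funext => x; rewrite /= big_nil mul0e.
  have [xi2 _] := mu_moment xi (mem2 i).
  have := integrableD measurableT xi2 IH.
  congr (integrable _ _ _); apply/funext => x /=.
  by rewrite big_cons xpowD xpow_mdelta expr2 EFinD.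
exact: (integrableD measurableT (integrable1 xi) (E _)).
Qed.

Lemma integrable_dominated xi g : dom g -> (mu xi).-integrable setT (EFin \o g).
Proof.
move=> [mg [C gC]].
apply: (le_integrable measurableT _ _ (integrableZl measurableT C (integrable_weight xi))).
  exact/measurable_EFinP.
move=> x _ /=; rewrite lee_fin (le_trans (gC x))//.
by rewrite ler_norm.
Qed.

Lemma int_muD g h xi : dom g -> dom h ->
  int_mu (fun x => g x + h x) xi = int_mu g xi + int_mu h xi.
Proof. by move=> dg dh; rewrite /int_mu RintegralD//; exact: integrable_dominated. Qed.

Lemma int_muZ c g xi : dom g -> int_mu (fun x => c * g x) xi = c * int_mu g xi.
Proof. by move=> dg; rewrite /int_mu RintegralZl//; exact: integrable_dominated. Qed.

(** The case [xi = 0] of the convexity hypothesis. *)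
Lemma mu_even xi (A : set (Rd R d)) : measurable A -> mu (- xi) A = mu xi A.
Proof.
move=> mA; suff le z : (mu z A <= mu (- z)%R A)%E.
  by apply/eqP; rewrite eq_le le andbT -{2}(opprK xi) le.
have := mu_convex 0 z mA; rewrite add0r sub0r.
have := mu_fin z mA; have := mu_fin (- z) mA.
move: (mu z A) (mu (- z) A) => [x| |]// [y| |]// _ _.
by rewrite -EFinM -!EFinD !lee_fin; lra.
Qed.

Lemma int_mu_even g xi : int_mu g (- xi) = int_mu g xi.
Proof.
rewrite /int_mu /Rintegral; congr fine; apply: eq_measure_integral => A mA _.
exact: mu_even.
Qed.

(** The second difference of [xi |-> int_mu g xi] in the direction [u]. *)
Definition diff2 g u eta : R :=
  int_mu g (eta + u) + int_mu g (eta - u) - 2 * int_mu g eta.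

Lemma diff2D g h u eta : dom g -> dom h ->
  diff2 (fun x => g x + h x) u eta = diff2 g u eta + diff2 h u eta.
Proof. by move=> dg dh; rewrite /diff2 !int_muD//; ring. Qed.

Lemma diff2Z c g u eta : dom g -> diff2 (fun x => c * g x) u eta = c * diff2 g u eta.
Proof. by move=> dg; rewrite /diff2 !int_muZ//; ring. Qed.

(** The convexity of the family, integrated. *)
Lemma diff2_ge0 g u eta : dom g -> (forall x, 0 <= g x) -> 0 <= diff2 g u eta.
Proof.
move=> dg g0; rewrite /diff2 -[eta - u]opprB int_mu_even [eta + u]addrC subr_ge0.
have mg : measurable_fun [set: Rd R d] (EFin \o g).
  by apply/measurable_EFinP; case: dg.
have fin xi : (\int[mu xi]_x (g x)%:E)%E \is a fin_num.
  by apply: integrable_fin_num => //; exact: integrable_dominated.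
have le : (\int[measure_add (mu eta) (mu eta)]_x (g x)%:E <=
    \int[measure_add (mu (u + eta)%R) (mu (u - eta)%R)]_x (g x)%:E)%E.
  apply: ge0_le_measure_integral => // A mA.
  rewrite /measure_add/= /msum !big_ord_recl !big_ord0 /= !adde0.
  have := mu_convex u eta mA.
  have := mu_fin eta mA; have := mu_fin (u + eta) mA; have := mu_fin (u - eta) mA.
  move: (mu eta A) (mu (u + eta) A) (mu (u - eta) A) => [x| |]// [y| |]// [z| |]// _ _ _.
  by rewrite -EFinM -!EFinD !lee_fin; lra.
move: le; rewrite !ge0_integral_measure_add//; try by move=> x _; rewrite lee_fin.
rewrite /int_mu /Rintegral.
move: (fin eta) (fin (u + eta)) (fin (u - eta)).
case: (\int[mu eta]_x (g x)%:E)%E => [x| |]//.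
case: (\int[mu (u + eta)%R]_x (g x)%:E)%E => [y| |]//.
case: (\int[mu (u - eta)%R]_x (g x)%:E)%E => [z| |]// _ _ _.
by rewrite -!EFinD lee_fin/=; lra.
Qed.

Lemma diff2_xpow n u eta : (N1 d `|` twoN1 d) n ->
  diff2 (xpow n) u eta = 2 * quad a n u.
Proof.
by move=> nN; rewrite /diff2 !int_mu_quad// quad_parallelogram; ring.
Qed.

Lemma weightE : @weight R d = (fun x => xpow 0 x +
  \sum_(i <- index_enum 'I_d) xpow (mdelta i + mdelta i) x).
Proof.
apply/funext => x; rewrite /weight xpow0; congr (_ + _).
by apply: eq_bigr => i _; rewrite xpowD xpow_mdelta expr2.
Qed.

Let dom_xpow2 i : dom (xpow (mdelta i + mdelta i)).
Proof.
have := @dominated_coord_sqr R d i; congr dominated; apply/funext => x.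
by rewrite xpowD xpow_mdelta expr2.
Qed.

Let dom_xpow0 : dom (xpow 0).
Proof.
by have := dominated_cst w1 1; congr dominated; apply/funext => x; rewrite xpow0.
Qed.

(** The second differences of the integrals of [weight] do not depend on the base
    point, because these integrals are quadratic forms. *)
Lemma diff2_weight u : exists K : R, forall eta, diff2 (@weight R d) u eta = K.
Proof.
exists (2 * quad a 0 u +
  \sum_(i <- index_enum 'I_d) 2 * quad a (mdelta i + mdelta i) u) => eta.
have dS (s : seq 'I_d) : dom (fun x => \sum_(i <- s) xpow (mdelta i + mdelta i) x).
  by apply: dominated_sum => //; exact: dominated_cst w1 _.
rewrite weightE diff2D// diff2_xpow//; congr (_ + _).
elim: (index_enum 'I_d) => [|i s IH].
  rewrite big_nil -[RHS](mul0r (diff2 (xpow 0) u eta)) -diff2Z//.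
  by congr (diff2 _ u eta); apply/funext => x; rewrite mul0r big_nil.
rewrite big_cons -IH -(diff2_xpow u eta (mem2 i)) -diff2D//.
by congr (diff2 _ u eta); apply/funext => x; rewrite big_cons.
Qed.

Lemma diff2_bdd g u : dom g -> bdd (diff2 g u).
Proof.
move=> dg; have [mg [C gC]] := dg; have [K wK] := diff2_weight u.
exists (C * K) => eta; rewrite -(wK eta).
have dw := dominated_weight R d; have dCw := dominatedZ C dw.
rewrite -diff2Z// ler_norml; apply/andP; split.
  rewrite -subr_ge0 opprK -diff2D//; apply: diff2_ge0; first exact: dominatedD.
  by move=> x; rewrite -lerBlDr sub0r; have := gC x; rewrite ler_norml => /andP[].
rewrite -subr_ge0 -[- diff2 g u eta]mulN1r -diff2Z// -diff2D//; last exact: dominatedZ.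
apply: diff2_ge0; first by apply: dominatedD => //; exact: dominatedZ.
by move=> x; rewrite mulN1r subr_ge0; have := gC x; rewrite ler_norml => /andP[].
Qed.

(** The mixed second difference; its invariant mean is biadditive. *)
Definition mixed g u v eta : R :=
  int_mu g (eta + u + v) + int_mu g (eta - u - v) -
  int_mu g (eta + u - v) - int_mu g (eta - u + v).

Lemma mixedE g u v : mixed g u v = fun eta => diff2 g (u + v) eta - diff2 g (u - v) eta.
Proof.
apply/funext => eta; rewrite /mixed /diff2 !opprD !opprK !addrA; ring.
Qed.

Lemma mixed_bdd g u v : dom g -> bdd (mixed g u v).
Proof.
move=> dg; rewrite mixedE.
have := bddD (diff2_bdd (u + v) dg) (bddZ (-1) (diff2_bdd (u - v) dg)).
by congr bdd; apply/funext => x; rewrite mulN1r.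
Qed.

(** Additivity of the mixed difference in its second direction, up to translations
    of the base point. *)
Lemma mixedD g u v v' eta :
  mixed g u (v + v') eta = mixed g u v (eta + v') + mixed g u v' (eta - v).
Proof.
rewrite /mixed !opprD.
have -> : eta + v' + u + v = eta + u + (v + v').
  by rewrite [v + v']addrC !addrA [eta + v' + u]addrAC.
have -> : eta - v - u - v' = eta - u + (- v - v').
  by rewrite !addrA [eta - v - u]addrAC.
have -> : eta + v' + u - v = eta - v + u + v'.
  by rewrite [LHS]addrAC [eta + v' - v]addrAC [LHS]addrAC.
have -> : eta + v' - u - v = eta - v - u + v'.
  by rewrite [LHS]addrAC [eta + v' - v]addrAC [LHS]addrAC.
have -> : eta + v' - u + v = eta - u + (v + v').
  by rewrite [v + v']addrC !addrA [eta + v' - u]addrAC.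
have -> : eta - v + u - v' = eta + u + (- v - v').
  by rewrite !addrA [eta - v + u]addrAC.
ring.
Qed.

(** Averaging the mixed second differences over the base point turns the family
    into a positive form, with the prescribed moments. *)
Lemma form_of_family : exists B : (Rd R d -> R) -> Xi R d -> Xi R d -> R,
  positive_form (@weight R d) B /\
  forall n k l, (N1 d `|` twoN1 d) n ->
    B (xpow n) (mon_vec R k) (mon_vec R l) = complex.Re (a (n + k + l)).
Proof.
have [M [MD MZ M0 M1 Ms]] := invariant_mean R (Xi R d).
(* [mixed] is a difference along [2 u] and [2 v]: on a quadratic form it is [8]
   times the polar form, hence the factor. *)
exists (fun g u v => 8^-1 * M (mixed g u v)); split; last first.
  move=> n k l nN; have -> : mixed (xpow n) (mon_vec R k) (mon_vec R l) =
      fun=> 8 * complex.Re (a (n + k + l)).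
    rewrite mixedE; apply/funext => eta; rewrite !diff2_xpow// -mulrBr quad_mono; ring.
  by rewrite M1 mulKf.
split.
- move=> g h u v dg dh; rewrite -mulrDr -MD; [|exact: mixed_bdd..].
  congr (_ * M _); apply/funext => eta; rewrite /mixed !int_muD//; ring.
- move=> c g u v dg; rewrite mulrCA -(MZ c); last exact: mixed_bdd.
  congr (_ * M _); apply/funext => eta; rewrite /mixed !int_muZ//; ring.
- move=> g u v dg; congr (_ * M _); apply/funext => eta; rewrite /mixed.
  by rewrite [eta + u + v]addrAC [eta - u - v]addrAC [eta + u - v]addrAC
    [eta - u + v]addrAC; ring.
- move=> g u v v' dg; rewrite -mulrDr; congr (_ * _).
  rewrite -(Ms v' (mixed g u v)); last exact: mixed_bdd.
  rewrite -(Ms (- v) (mixed g u v')); last exact: mixed_bdd.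
  rewrite -MD; [|exact/bdd_shift/mixed_bdd..].
  by congr M; apply/funext => eta; exact: mixedD.
- move=> g u dg g0; rewrite mulr_ge0 ?invr_ge0//; apply: M0.
    exact: mixed_bdd.
  move=> eta; rewrite mixedE subrr.
  have -> : diff2 g 0 eta = 0 by rewrite /diff2 subr0 addr0; ring.
  by rewrite subr0; exact: diff2_ge0.
Qed.

End FormOfFamily.

Theorem family_moment (R : realType) (d : nat) (a : multiindex d -> R[i])
    (mu : Xi R d -> {measure set (Rd R d) -> \bar R}) :
  (forall (xi : Xi R d) (n : multiindex d),
     (N1 d `|` twoN1 d) n -> has_moment (mu xi) n (axi a xi n)) ->
  (forall (xi eta : Xi R d) (A : set (Rd R d)), measurable A ->
     (0 <= mu (xi + eta)%R A + mu (xi - eta)%R A - 2%:E * mu eta A)%E) ->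
  moment_sequence a.
Proof.
move=> mu_moment mu_convex.
have [B [pB BE]] := form_of_family mu_moment mu_convex.
have mem0 : (N1 d `|` twoN1 d) 0 by left; rewrite /N1/= absm0.
have B1 k l : B (fun=> 1) (mon_vec R k) (mon_vec R l) = complex.Re (a (k + l)).
  rewrite -[k + l]add0r addrA -BE//; congr (B _ _ _).
  by apply/funext => x; rewrite xpow0.
have BX k l i : B (fun x => x 0 i) (mon_vec R k) (mon_vec R l) =
    complex.Re (a (mdelta i + k + l)).
  rewrite -BE; last by left; rewrite /N1/= absm_mdelta.
  by congr (B _ _ _); apply/funext => x; rewrite xpow_mdelta.
have BX2 k l i : B (fun x => x 0 i ^+ 2) (mon_vec R k) (mon_vec R l) =
    complex.Re (a (mdelta i + mdelta i + k + l)).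
  rewrite -BE; last by right; exists (mdelta i); rewrite ?mulr2n// /N1/= absm_mdelta.
  by congr (B _ _ _); apply/funext => x; rewrite xpowD xpow_mdelta expr2.
have [nu nuE] := moments_of_form (al := fun k => complex.Re (a k)) pB B1 BX BX2.
exists nu => n; have [inu nuI] := nuE n; split => //; rewrite -nuI.
(* The values [a n] are real: polarize the real numbers [axi a xi 0]. *)
have real xi : complex.Im (axi a xi 0) = 0.
  by have [_ ->] := mu_moment xi 0 mem0.
have axiE xi : axi a xi 0 = sesq a 0 xi xi by [].
have rD k : complex.Im (a (k + k)) = 0.
  by have := real (mon_vec R k); rewrite axiE sesq_mono add0r.
have := real (mon_vec R n + mon_vec R 0).
rewrite axiE !(sesqDl, sesqDr) !sesq_mono !add0r !addr0 !raddfD/=.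
have := rD 0; rewrite addr0 => ->; rewrite rD add0r addr0 => im2.
have im : complex.Im (a n) = 0 by lra.
by case: (a n) im => x y /= ->.
Qed.

(** * Measures with densities *)

Section Density.
Context {disp : measure_display} {T : measurableType disp} {R : realType}.
Variables (mu : {measure set T -> \bar R}) (f : T -> R).
Hypothesis mf : measurable_fun [set: T] f.
Hypothesis f0 : forall x, 0 <= f x.

(** The measure with density [f] with respect to [mu]. *)
Definition density (A : set T) : \bar R := (\int[mu]_(x in A) (f x)%:E)%E.

Let density0 : density set0 = 0%E.
Proof. exact: integral_set0. Qed.

Let density_ge0 A : (0 <= density A)%E.
Proof. by apply: integral_ge0 => x _; rewrite lee_fin. Qed.

Let density_sigma_additive : semi_sigma_additive density.
Proof.
apply: semi_sigma_additive_nng_induced; first exact/measurable_EFinP.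
by move=> x; rewrite lee_fin.
Qed.

HB.instance Definition _ := measure_function.isMeasure.Build _ _ _ density
  density0 density_ge0 density_sigma_additive.

Import HBNNSimple.

Let density_indic (A : set T) : measurable A ->
  (\int[density]_x (\1_A x)%:E = \int[mu]_x (\1_A x * f x)%:E)%E.
Proof.
move=> mA; rewrite integral_indic// setIT -[LHS]/(density A) /density.
rewrite [LHS]integral_mkcond.
apply: eq_integral => x _; rewrite patchE indicE.
by case: (x \in A); rewrite ?mul1r ?mul0r.
Qed.

(* The change of density formula for simple functions; the general case follows
   by monotone convergence. *)
Let density_nnsfun (h : {nnsfun T >-> R}) :
  (\int[density]_x (h x)%:E = \int[mu]_x (h x * f x)%:E)%E.
Proof.
have hE x : (h x)%:E = (\sum_(y \in range h) (y * \1_(h @^-1` [set y]) x)%:E)%E.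
  by rewrite fimfunE -fsumEFin.
have y0 y x : (0 <= (y * \1_(h @^-1` [set y]) x)%:E)%E.
  by rewrite EFinM nnfun_muleindic_ge0.
transitivity (\int[density]_x
    (\sum_(y \in range h) (y * \1_(h @^-1` [set y]) x)%:E))%E.
  by apply: eq_integral => x _; exact: hE.
rewrite ge0_integral_fsum//; last first.
  by move=> y; apply/measurable_EFinP/measurable_funM.
transitivity (\int[mu]_x (\sum_(y \in range h)
    ((y * \1_(h @^-1` [set y]) x)%:E * (f x)%:E)))%E; last first.
  by apply: eq_integral => x _; rewrite EFinM hE ge0_mule_fsuml.
rewrite ge0_integral_fsum//; last 2 first.
- move=> y; apply/measurable_EFinP/measurable_funM => //.
  exact: measurable_funM.
- by move=> y x _; rewrite mule_ge0// lee_fin.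
apply: eq_fsbigr => y; rewrite inE => -[t _ <-].
have ht0 : 0 <= h t by [].
have mA : measurable (h @^-1` [set h t]) by [].
under eq_integral do rewrite EFinM.
rewrite ge0_integralZl//; last exact/measurable_EFinP/measurable_indic.
  under [RHS]eq_integral do rewrite -EFinM -mulrA EFinM.
  rewrite ge0_integralZl ?density_indic//.
    by apply/measurable_EFinP/measurable_funM => //; exact: measurable_indic.
  by move=> x _; rewrite lee_fin mulr_ge0.
Qed.

Lemma ge0_integral_density (g : T -> R) : measurable_fun [set: T] g ->
  (forall x, 0 <= g x) ->
  (\int[density]_x (g x)%:E = \int[mu]_x (g x * f x)%:E)%E.
Proof.
move=> mg g0.
have mEg : measurable_fun [set: T] (EFin \o g) by exact/measurable_EFinP.
pose h := nnsfun_approx measurableT mEg.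
have hg x : (h n x)%:E @[n --> \oo] --> (g x)%:E.
  by apply: cvg_nnsfun_approx => // y _; rewrite lee_fin.
have hg' x : h n x @[n --> \oo] --> g x by have /fine_cvgP[] := hg x.
have hnd x : nondecreasing_seq (fun n => (h n x)%:E).
  by move=> m n mn; rewrite lee_fin; exact/lefP/nd_nnsfun_approx.
have mh n : measurable_fun [set: T] (h n) by [].
have lim1 := @cvg_monotone_convergence _ _ _ density setT measurableT
  (fun n x => (h n x)%:E) _ _ _.
have lim2 := @cvg_monotone_convergence _ _ _ mu setT measurableT
  (fun n x => (h n x * f x)%:E) _ _ _.
have L1 : (\int[density]_x (h n x)%:E)%E @[n --> \oo] --> (\int[density]_x (g x)%:E)%E.
  rewrite (_ : (\int[density]_x (g x)%:E)%E =
      (\int[density]_x limn (fun n => (h n x)%:E))%E); last first.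
    by apply: eq_integral => x _; apply/esym/cvg_lim => //; exact: hg.
  apply: lim1 => [n|n x _|x _]; last exact: hnd.
    by have /measurable_EFinP := mh n.
  by rewrite lee_fin.
have L2 : (\int[mu]_x (h n x * f x)%:E)%E @[n --> \oo] -->
    (\int[mu]_x (g x * f x)%:E)%E.
  rewrite (_ : (\int[mu]_x (g x * f x)%:E)%E =
      (\int[mu]_x limn (fun n => (h n x * f x)%:E))%E); last first.
    apply: eq_integral => x _; apply/esym/cvg_lim => //.
    apply/cvg_EFin; first by near=> n.
    by apply: cvgMl; exact: hg'.
  apply: lim2 => [n|n x _|x _ m n mn].
  - by have /measurable_EFinP := measurable_funM (mh n) mf.
  - by rewrite lee_fin mulr_ge0.
  - by rewrite lee_fin ler_wpM2r// -lee_fin hnd.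
have E : (fun n => \int[mu]_x (h n x * f x)%:E)%E =
    (fun n => \int[density]_x (h n x)%:E)%E.
  by apply/funext => n; rewrite density_nnsfun.
by rewrite E in L2; exact: (cvg_unique (@ereal_hausdorff R) L1 L2).
Unshelve. all: by end_near. Qed.

Lemma integral_density (g : T -> R) : measurable_fun [set: T] g ->
  mu.-integrable setT (EFin \o (fun x => g x * f x)) ->
  density.-integrable setT (EFin \o g) /\
  \int[density]_x g x = \int[mu]_x (g x * f x).
Proof.
move=> mg igf.
have mEg : measurable_fun [set: T] (EFin \o g) by exact/measurable_EFinP.
have intg : density.-integrable setT (EFin \o g).
  apply/integrableP; split => //=.
  rewrite (ge0_integral_density (g := fun x => `|g x|))//; last first.
    exact: measurableT_comp.
  case/integrableP: igf => _; congr (_ < _)%E; apply: eq_integral => x _ /=.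
  by rewrite normrM (ger0_norm (f0 x)).
split => //; rewrite /Rintegral; congr fine.
rewrite integralE [RHS]integralE; congr (_ - _)%E.
- under eq_integral => x _.
    rewrite (_ : ((fun x => (g x)%:E)^\+ x)%E = (Num.max (g x) 0)%:E);
      last by rewrite funeposE EFin_max.
    over.
  rewrite (ge0_integral_density (g := fun x => Num.max (g x) 0)).
  + apply: eq_integral => x _; rewrite funeposE -EFin_max.
    by rewrite maxr_pMl// mul0r.
  + by apply: measurable_maxr.
  + by move=> x; rewrite le_max lexx orbT.
- under eq_integral => x _.
    rewrite (_ : ((fun x => (g x)%:E)^\- x)%E = (Num.max (- g x) 0)%:E);
      last by rewrite funenegE EFin_max EFinN.
    over.
  rewrite (ge0_integral_density (g := fun x => Num.max (- g x) 0)).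
  + apply: eq_integral => x _; rewrite funenegE -EFinN -EFin_max.
    by rewrite maxr_pMl// mul0r mulNr.
  + by apply: measurable_maxr => //; exact: measurable_funN.
  + by move=> x; rewrite le_max lexx orbT.
Qed.

Lemma density_measure : exists nu : {measure set T -> \bar R},
  (forall A, nu A = \int[mu]_(x in A) (f x)%:E)%E /\
  forall g : T -> R, measurable_fun [set: T] g ->
    mu.-integrable setT (EFin \o (fun x => g x * f x)) ->
    nu.-integrable setT (EFin \o g) /\
    \int[nu]_x g x = \int[mu]_x (g x * f x).
Proof. by exists density; split => //; exact: integral_density. Qed.

End Density.

(** * From a representing measure to a convex family *)

Section FiniteSums.
Context {disp : measure_display} {T : measurableType disp} {R : realType}.
Variable mu : {measure set T -> \bar R}.

Lemma Rintegral_sum (I : Type) (s : seq I) (F : I -> T -> R) :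
  (forall i, mu.-integrable setT (EFin \o F i)) ->
  mu.-integrable setT (EFin \o (fun x => \sum_(i <- s) F i x)) /\
  \int[mu]_x (\sum_(i <- s) F i x) = \sum_(i <- s) \int[mu]_x F i x.
Proof.
move=> iF; elim: s => [|i s [iS IH]].
  rewrite big_nil; have -> : (fun x => \sum_(i <- [::]) F i x) = fun=> 0.
    by apply/funext => x; rewrite big_nil.
  split; first exact: integrable0.
  by rewrite /Rintegral integral0.
rewrite big_cons -IH -RintegralD//.
have -> : (fun x => \sum_(j <- i :: s) F j x) =
    (fun x => F i x + \sum_(j <- s) F j x).
  by apply/funext => x; rewrite big_cons.
by split => //; exact: (integrableD measurableT (iF i) iS).
Qed.

End FiniteSums.

Section FamilyOfMeasure.
Variables (R : realType) (d : nat) (a : multiindex d -> R[i]).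
Variable mu : {measure set (Rd R d) -> \bar R}.
Hypothesis mu_moment : forall n, has_moment mu n (a n).
Implicit Types (xi eta : Xi R d) (x : Rd R d).

(** The value at [x] of the polynomial with coefficients [xi], and its squared
    modulus. *)
Definition pval xi x : R[i] :=
  \sum_(k <- msupp xi) mcoeff k xi * ((xpow k x)%:C)%C.

Definition sqmod xi x : R := complex.Re (pval xi x) ^+ 2 + complex.Im (pval xi x) ^+ 2.

Lemma sqmod_ge0 xi x : 0 <= sqmod xi x.
Proof. by rewrite addr_ge0// sqr_ge0. Qed.

Lemma pvalD xi eta x : pval (xi + eta) x = pval xi x + pval eta x.
Proof.
apply: (@msum_add _ _ (fun k y => y * ((xpow k x)%:C)%C)) => k y z.
by rewrite mulrDl.
Qed.

Lemma pval0 x : pval 0 x = 0.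
Proof. by rewrite /pval msupp0 big_seq_fset0. Qed.

Lemma pvalN xi x : pval (- xi) x = - pval xi x.
Proof. by apply/eqP; rewrite -addr_eq0 -pvalD addNr pval0. Qed.

Lemma sqmod_parallelogram xi eta x :
  sqmod (xi + eta) x + sqmod (xi - eta) x = 2 * sqmod xi x + 2 * sqmod eta x.
Proof.
rewrite /sqmod !pvalD pvalN.
by case: (pval xi x) (pval eta x) => [? ?] [? ?] /=; ring.
Qed.

(** The coefficients of the squared modulus of the polynomial [xi]. *)
Definition crossRe xi k l : R := complex.Re (mcoeff k xi * (mcoeff l xi)^*%C).

Lemma sqmod_expand xi n x : xpow n x * sqmod xi x =
  \sum_(k <- msupp xi) \sum_(l <- msupp xi) crossRe xi k l * xpow (n + k + l) x.
Proof.
have -> : sqmod xi x = complex.Re (pval xi x * (pval xi x)^*%C).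
  by rewrite /sqmod; case: (pval xi x) => u v /=; ring.
rewrite {1}/pval mulr_suml (big_morph _ (@ReD R) (erefl : complex.Re 0 = 0)) mulr_sumr.
apply: eq_bigr => k _; rewrite /pval rmorph_sum mulr_sumr.
rewrite (big_morph _ (@ReD R) (erefl : complex.Re 0 = 0)) mulr_sumr.
apply: eq_bigr => l _; rewrite /crossRe !xpowD rmorphM/=.
by case: (mcoeff k xi) (mcoeff l xi) => [u v] [u' v'] /=; ring.
Qed.

Lemma sqmod_borel xi : measurable_fun [set: Rd R d] (sqmod xi).
Proof.
have -> : sqmod xi = (fun x => \sum_(k <- msupp xi) \sum_(l <- msupp xi)
    crossRe xi k l * xpow (0 + k + l) x).
  by apply/funext => x; rewrite -sqmod_expand xpow0 mul1r.
apply: measurable_sum => k; apply: measurable_sum => l.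
by apply: measurable_funM => //; exact: xpow_borel.
Qed.

Lemma moment_real n : a n = ((\int[mu]_x xpow n x)%:C)%C.
Proof. by have [] := mu_moment n. Qed.

Lemma axi_real xi n : axi a xi n = ((quad a n xi)%:C)%C.
Proof.
have conj : (axi a xi n)^*%C = axi a xi n.
  rewrite /axi rmorph_sum/= exchange_big/=; apply: eq_bigr => k _.
  rewrite rmorph_sum/=; apply: eq_bigr => l _.
  rewrite !rmorphM/= conjcK [n + k + l]addrAC moment_real conjc_real.
  by rewrite mulrAC.
rewrite /quad; case: (axi a xi n) conj => u v [/eqP].
by rewrite eq_sym -addr_eq0 -mulr2n mulrn_eq0/= => /eqP ->.
Qed.

Lemma sqmod_moment xi n :
  mu.-integrable setT (EFin \o (fun x => xpow n x * sqmod xi x)) /\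
  \int[mu]_x (xpow n x * sqmod xi x) = quad a n xi.
Proof.
have -> : (fun x => xpow n x * sqmod xi x) = (fun x => \sum_(k <- msupp xi)
    \sum_(l <- msupp xi) crossRe xi k l * xpow (n + k + l) x).
  by apply/funext => x; exact: sqmod_expand.
have iF k l : mu.-integrable setT
    (EFin \o (fun x => crossRe xi k l * xpow (n + k + l) x)).
  by have [iX _] := mu_moment (n + k + l); exact: (integrableZl measurableT _ iX).
have inner k := Rintegral_sum (msupp xi) (iF k).
have [iS ->] := Rintegral_sum (msupp xi) (fun k => (inner k).1).
split => //; rewrite /quad /axi (big_morph _ (@ReD R) (erefl : complex.Re 0 = 0)).
apply: eq_bigr => k _; rewrite (inner k).2.
rewrite (big_morph _ (@ReD R) (erefl : complex.Re 0 = 0)); apply: eq_bigr => l _.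
have [iX ->] := mu_moment (n + k + l).
rewrite RintegralZl// /crossRe -mulrA.
by case: (mcoeff k xi) (mcoeff l xi) => [u v] [u' v'] /=; ring.
Qed.

(** The measures with densities [sqmod xi] form the required family, by the
    parallelogram law for the squared modulus. *)
Lemma family_of_moment : exists nu : Xi R d -> {measure set (Rd R d) -> \bar R},
  [/\ forall xi n, has_moment (nu xi) n (axi a xi n),
      forall A : set (Rd R d), nu 0 A = 0%E
    & forall xi eta (A : set (Rd R d)), measurable A ->
        (0 <= nu (xi + eta)%R A + nu (xi - eta)%R A - 2%:E * nu eta A)%E].
Proof.
have /choice[nu nuP] xi := density_measure mu (@sqmod_borel xi) (sqmod_ge0 xi).
exists nu; split.
- move=> xi n; have [_ nuI] := nuP xi.
  have [iS IS] := sqmod_moment xi n.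
  have [iX IX] := nuI _ (@xpow_borel R d n) iS.
  by split => //; rewrite IX IS axi_real.
- move=> A; have [-> _] := nuP 0.
  rewrite (eq_integral (fun=> 0%E)) ?integral0// => x _.
  by rewrite /sqmod pval0 expr0n addr0.
- move=> xi eta A mA; have [-> _] := nuP (xi + eta); have [-> _] := nuP (xi - eta).
  have [-> _] := nuP eta.
  have ms z : measurable_fun A (fun x => (sqmod z x)%:E).
    by apply: measurable_funTS; have /measurable_EFinP := @sqmod_borel z.
  have s0 z x : A x -> (0 <= (sqmod z x)%:E)%E by rewrite lee_fin sqmod_ge0.
  have fin : (\int[mu]_(x in A) (sqmod eta x)%:E)%E \is a fin_num.
    apply: integrable_fin_num => //; apply: (integrableS measurableT) => //.
    have [+ _] := sqmod_moment eta 0; congr (integrable _ _ _).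
    by apply/funext => x; rewrite /= xpow0 mul1r.
  rewrite -(ge0_integralD mu mA (s0 (xi + eta)) (ms _) (s0 (xi - eta)) (ms _)).
  have Z := @ge0_integralZl _ _ _ mu A mA _ (ms eta) 2%:E (s0 eta).
  rewrite sube_ge0; last by rewrite fin_numM.
  rewrite -Z; last by rewrite lee_fin.
  apply: ge0_le_integral => //.
  + by move=> x _; rewrite -EFinM lee_fin mulr_ge0// sqmod_ge0.
  + by apply: measurable_funeM; exact: ms.
  + by apply: emeasurable_funD; exact: ms.
  + move=> x _; rewrite -EFinM -EFinD lee_fin sqmod_parallelogram.
    by rewrite lerDr mulr_ge0// sqmod_ge0.
Qed.

End FamilyOfMeasure.

(** * The characterization *)

Theorem theorem3 (R : realType) (d : nat) (hd : (1 <= d)%N)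
    (a : multiindex d -> R[i]) :
  moment_sequence a <->
  exists mu : Xi R d -> {measure set (Rd R d) -> \bar R},
    [/\ forall (xi : Xi R d) (n : multiindex d), (N1 d `|` twoN1 d) n ->
          has_moment (mu xi) n (axi a xi n),
        forall A : set (Rd R d), measurable A -> mu 0 A = 0%E
      & forall (xi eta : Xi R d) (A : set (Rd R d)), measurable A ->
          (0 <= mu (xi + eta)%R A + mu (xi - eta)%R A - 2%:E * mu eta A)%E].
Proof.
split => [[mu muE]|[mu [muE _ muC]]]; last exact: family_moment muE muC.
have [nu [nuE nu0 nuC]] := family_of_moment muE.
by exists nu; split => // xi n _; exact: nuE.
Qed.
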